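(* Let $A$ and $B$ be irreducible, non-permutation square matrices with entries in $\{0,1\}$. Suppose that $(X_A,\sigma_A)$ and $(X_B,\sigma_B)$ are continuously orbit equivalent via a homeomorphism $h:X_A\to X_B$, and let $\Psi_h:C(X_B,\mathbb{Z})\to C(X_A,\mathbb{Z})$ be the associated homomorphism defined in the context. Then the following assertions hold. (i) There exists an isomorphism $\Phi:\mathcal{O}_A\to\mathcal{O}_B$ such that $\Phi(\mathcal{D}_A)=\mathcal{D}_B$ and $$\Phi\circ\rho^{A,\Psi_h(f)}_t=\rho^{B,f}_t\circ\Phi,\qquad f\in C(X_B,\mathbb{Z}),\ t\in\mathbb{T}.$$ (ii) There exists an isomorphism of groups $\xi:\Gamma_A\to\Gamma_B$ such that $$\xi(\Gamma_{A,\Psi_h(f)})=\Gamma_{B,f},\qquad f\in C(X_B,\mathbb{Z}).$$ (iii) There exists an isomorphism $\Phi_h:H^1(\Gamma_A,X_A;\mathbb{Z})\to H^1(\Gamma_B,X_B;\mathbb{Z})$ of the cohomology groups such that $$\Phi_h([\rho^{\Psi_h(f)}])=[\rho^f],\qquad f\in C(X_B,\mathbb{Z}).$$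
   Context: For an irreducible non-permutation matrix $A=[A(i,j)]_{i,j=1}^N$ with entries in $\{0,1\}$, $X_A$ is the set of sequences $(x_n)_{n\in\mathbb{N}}$, $x_n\in\{1,\dots,N\}$, with $A(x_n,x_{n+1})=1$ for all $n\in\mathbb{N}$, with the product topology, and $\sigma_A((x_n)_n)=(x_{n+1})_n$. $C(X_A,\mathbb{Z})$ is the abelian group of continuous functions $X_A\to\mathbb{Z}$; $\mathbb{Z}_+$ is the set of nonnegative integers. For $f\in C(X_A,\mathbb{Z})$ and $m\in\mathbb{Z}_+$, $f^m(x)=\sum_{i=0}^{m-1}f(\sigma_A^i(x))$ (so $f^0=0$). Continuous orbit equivalence via a homeomorphism $h:X_A\to X_B$: there exist continuous $k_1,l_1:X_A\to\mathbb{Z}_+$ and $k_2,l_2:X_B\to\mathbb{Z}_+$ with $\sigma_B^{k_1(x)}(h(\sigma_A(x)))=\sigma_B^{l_1(x)}(h(x))$ for $x\in X_A$ and $\sigma_A^{k_2(w)}(h^{-1}(\sigma_B(w)))=\sigma_A^{l_2(w)}(h^{-1}(w))$ for $w\in X_B$. Then for $f\in C(X_B,\mathbb{Z})$, $\Psi_h(f)(z)=f^{l_1(z)}(h(z))-f^{k_1(z)}(h(\sigma_A(z)))$, $z\in X_A$. Continuous full group: $\Gamma_A$ is the group of homeomorphisms $\tau$ of $X_A$ for which there are continuous $k_\tau,l_\tau:X_A\to\mathbb{Z}_+$ with $\sigma_A^{k_\tau(x)}(\tau(x))=\sigma_A^{l_\tau(x)}(x)$ for all $x\in X_A$. It is regarded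 as a discrete group. For $f\in C(X_A,\mathbb{Z})$ put $\rho^f(x,\tau)=f^{l_\tau(x)}(x)-f^{k_\tau(x)}(\tau(x))$ for $(x,\tau)\in X_A\times\Gamma_A$ (independent of the choice of $k_\tau,l_\tau$), and $\Gamma_{A,f}=\{\tau\in\Gamma_A\mid \rho^f(x,\tau)=0\text{ for all }x\in X_A\}$ (the cocycle subgroup). The same definitions apply to $B$. Cohomology: $Z^1(\Gamma_A,X_A;\mathbb{Z})$ is the additive group of continuous functions $\rho:X_A\times\Gamma_A\to\mathbb{Z}$ with $\rho(x,\tau_2\circ\tau_1)=\rho(x,\tau_1)+\rho(\tau_1(x),\tau_2)$; $B^1(\Gamma_A,X_A;\mathbb{Z})$ is its subgroup of functions $\delta_g(x,\tau)=g(x)-g(\tau(x))$, $g\in C(X_A,\mathbb{Z})$; $H^1(\Gamma_A,X_A;\mathbb{Z})=Z^1/B^1$. One has $\rho^f\in Z^1(\Gamma_A,X_A;\mathbb{Z})$; $[\cdot]$ denotes the class in $H^1$. Cuntz–Krieger algebra: $\mathcal{O}_A$ is the universal $C^*$-algebra generated by partial isometries $S_1,\dots,S_N$ with $\sum_{j=1}^N S_jS_j^*=1$ and $S_i^*S_i=\sum_{j=1}^N A(i,j)S_jS_j^*$ for $i=1,\dots,N$. $\mathcal{D}_A$ is the $C^*$-subalgebra generated by the projections $S_\mu S_\mu^*$ for admissible words $\mu=(\mu_1,\dots,\mu_n)$ of $X_A$, $S_\mu=S_{\mu_1}\cdots S_{\mu_n}$; it is identified with $C(X_A)$ by letting $S_\mu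 S_\mu^*$ correspond to the characteristic function of the cylinder set of $\mu$. Let $\mathbb{T}=\mathbb{R}/\mathbb{Z}$. For $f\in C(X_A,\mathbb{Z})$, written as $f=\sum_i f_iS_{\mu(i)}S_{\mu(i)}^*$ with $f_i\in\mathbb{Z}$ and $\sum_i S_{\mu(i)}S_{\mu(i)}^*=1$, $e^{2\pi\sqrt{-1}tf}$ denotes the unitary $\sum_i e^{2\pi\sqrt{-1}f_it}S_{\mu(i)}S_{\mu(i)}^*\in\mathcal{D}_A$, and the generalized gauge action $\rho^{A,f}:\mathbb{T}\to\mathrm{Aut}(\mathcal{O}_A)$ is defined by $\rho^{A,f}_t(S_j)=e^{2\pi\sqrt{-1}tf}S_j$, $j=1,\dots,N$. Isomorphisms of $C^*$-algebras are $*$-isomorphisms. *)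

(* Defs.v *)
From HB Require Import structures.
From mathcomp Require Import all_boot all_order all_algebra.
From mathcomp Require Import complex.
From mathcomp Require Import all_classical all_reals all_analysis.

Set Implicit Arguments.
Unset Strict Implicit.
Unset Printing Implicit Defensive.

Import Order.TTheory GRing.Theory Num.Theory.
Import numFieldNormedType.Exports.

Local Open Scope classical_set_scope.
Local Open Scope ring_scope.

(** * Unital C*-algebras *)

(* [GRing.Algebra] is built on nonzero unital rings, so the zero algebra is
   excluded.  The norm is a separate field because Hierarchy Builder cannot
   join [CompleteNormedModule] with [GRing.Algebra].  Completeness is stated
   for Cauchy sequences. *)
HB.mixin Record isCStarAlgebra (R : realType) (T : Type)
    of GRing.Algebra R[i] T := {
  cstar : T -> T;
  cnorm : T -> R;
  cstarD : {morph cstar : x y / x + y};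
  cstarZ : forall (a : R[i]) (x : T), cstar (a *: x) = (a^*)%C *: cstar x;
  cstarM : forall x y : T, cstar (x * y) = cstar y * cstar x;
  cstarK : involutive cstar;
  cnorm_eq0 : forall x : T, cnorm x = 0 -> x = 0;
  cnormZ : forall (a : R[i]) (x : T),
    cnorm (a *: x) = ComplexField.Normc.normc a * cnorm x;
  cnormD : forall x y : T, cnorm (x + y) <= cnorm x + cnorm y;
  cnormM : forall x y : T, cnorm (x * y) <= cnorm x * cnorm y;
  cnorm_cstar : forall x : T, cnorm (cstar x * x) = cnorm x ^+ 2;
  cnorm_complete : forall u : nat -> T,
    (forall e : R, 0 < e ->
       exists n0, forall m n, (n0 <= m)%N -> (n0 <= n)%N ->
         cnorm (u m - u n) < e) ->
    exists l : T, (fun n => cnorm (u n - l)) @ \oo --> (0 : R)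
}.

#[short(type="cstarAlgType")]
HB.structure Definition CStarAlgebra (R : realType) :=
  {T of isCStarAlgebra R T & GRing.Algebra R[i] T}.

Section CStar.
Context {R : realType}.

(* A norm-closed *-subalgebra, not required to contain 1. *)
Definition cstar_subalgebra (U : cstarAlgType R) (D : set U) : Prop :=
  [/\ D 0,
      forall (a : R[i]) x y, D x -> D y -> D (a *: x + y),
      forall x y, D x -> D y -> D (x * y),
      forall x, D x -> D (cstar x)
    & forall (u : nat -> U) (l : U), (forall n, D (u n)) ->
        (fun n => cnorm (u n - l)) @ \oo --> (0 : R) -> D l].

Definition cstar_generated (U : cstarAlgType R) (G : set U) : set U :=
  smallest (@cstar_subalgebra U) G.

(* Together with [{lrmorphism U -> V}] this says that [phi] is a unital
   *-homomorphism. *)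
Definition star_morphism (U V : cstarAlgType R) (phi : U -> V) : Prop :=
  {morph phi : x / cstar x}.

End CStar.

(** * Matrices and one-sided topological Markov shifts *)

Definition zero_one_mx N (A : 'M[nat]_N) : Prop :=
  forall i j, A i j = 0%N \/ A i j = 1%N.

Definition irreducible_mx N (A : 'M[nat]_N) : Prop :=
  forall i j, exists n : nat, (0 < (A ^+ n.+1) i j)%N.

Definition markov_set N (A : 'M[nat]_N) :
    set (prod_topology (fun _ : nat => discrete_topology 'I_N)) :=
  [set x | forall n, A (x n) (x n.+1) = 1%N].

(* [set_type] carries the topology induced by the product topology. *)
Definition markov_shift N (A : 'M[nat]_N) : topologicalType :=
  set_type (markov_set A).

Section Shift.
Context {N : nat} {A : 'M[nat]_N}.

Lemma sigma_subproof (x : markov_shift A) :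
  (fun n => val x n.+1) \in markov_set A.
Proof. by apply/mem_set => n; exact: (set_mem (valP x) n.+1). Qed.

Definition sigma (x : markov_shift A) : markov_shift A :=
  exist (fun y => y \in markov_set A) _ (sigma_subproof x).

Definition birkhoff (f : markov_shift A -> int) (m : nat)
    (x : markov_shift A) : int :=
  \sum_(i < m) f (iter i sigma x).

Definition in_cylinder (mu : seq 'I_N) (x : markov_shift A) : bool :=
  mkseq (val x) (size mu) == mu.

End Shift.

Definition continuous_int (T : topologicalType) (f : T -> int) : Prop :=
  continuous (f : T -> discrete_topology int).

Definition homeomorphism (T U : topologicalType) (h : T -> U) (g : U -> T) :
    Prop :=
  [/\ continuous h, continuous g, cancel h g & cancel g h].

(** * Continuous orbit equivalence *)

Section OrbitEquivalence.
Context {N M : nat} {A : 'M[nat]_N} {B : 'M[nat]_M}.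

Definition orbit_cocycles (h : markov_shift A -> markov_shift B)
    (k l : markov_shift A -> nat) : Prop :=
  [/\ continuous k, continuous l
    & forall x, iter (k x) sigma (h (sigma x)) = iter (l x) sigma (h x)].

Definition Psi_map (h : markov_shift A -> markov_shift B)
    (k l : markov_shift A -> nat) (f : markov_shift B -> int) (z : markov_shift A) : int :=
  birkhoff f (l z) (h z) - birkhoff f (k z) (h (sigma z)).

End OrbitEquivalence.

(** * The continuous full group *)

Section FullGroup.
Context {N : nat}.
Variable A : 'M[nat]_N.

Definition full_group_set : set (markov_shift A -> markov_shift A) :=
  [set tau | (exists g, homeomorphism tau g) /\
     exists kl : (markov_shift A -> nat) * (markov_shift A -> nat),
       [/\ continuous kl.1, continuous kl.2
         & forall x, iter (kl.1 x) sigma (tau x) = iter (kl.2 x) sigma x]].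

Definition full_group : Type := set_type full_group_set.

HB.instance Definition _ := Choice.on full_group.

Definition full_group_fun (t : full_group) : markov_shift A -> markov_shift A := val t.

Lemma full_group_inj (s t : full_group) : full_group_fun s =1 full_group_fun t -> s = t.
Proof. by move=> st; apply: val_inj; apply/funext. Qed.

Lemma full_group_homeo (t : full_group) : exists g, homeomorphism (full_group_fun t) g.
Proof. by case: (set_mem (valP t)). Qed.

Lemma full_group_cocycles (t : full_group) :
  exists kl : (markov_shift A -> nat) * (markov_shift A -> nat),
    [/\ continuous kl.1, continuous kl.2
      & forall x, iter (kl.1 x) sigma (full_group_fun t x)
                  = iter (kl.2 x) sigma x].
Proof. by case: (set_mem (valP t)). Qed.

Definition full_group_inv_fun (t : full_group) : markov_shift A -> markov_shift A :=
  projT1 (cid (full_group_homeo t)).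

Lemma full_group_inv_funP (t : full_group) :
  homeomorphism (full_group_fun t) (full_group_inv_fun t).
Proof. exact: projT2 (cid (full_group_homeo t)). Qed.

Let continuous_natP (T : topologicalType) (k : T -> nat) :
  continuous k <-> forall x, nbhs x [set y | k y = k x].
Proof.
split=> [ck x|H x].
  by apply: (ck x [set k x]); exact: discrete_set1.
by apply/discrete_cvg; exact: H.
Qed.

Let continuous_natD (T : topologicalType) (k l : T -> nat) :
  continuous k -> continuous l -> continuous (fun x => k x + l x)%N.
Proof.
move=> /continuous_natP ck /continuous_natP cl; apply/continuous_natP => x.
by apply: filterS2 (ck x) (cl x) => y /= -> ->.
Qed.

Let continuous_nat_comp (T U : topologicalType) (h : T -> U) (k : U -> nat) :
  continuous h -> continuous k -> continuous (k \o h).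
Proof. by move=> ch ck x; apply: continuous_comp; [exact: ch|exact: ck]. Qed.

Lemma full_group_one_subproof : id \in full_group_set.
Proof.
apply/mem_set; split; first by exists id; split => // x U.
by exists (cst 0%N, cst 0%N); split=> [x|x|x] //=; exact: cst_continuous.
Qed.

Lemma full_group_mul_subproof (s t : full_group) :
  (full_group_fun s \o full_group_fun t) \in full_group_set.
Proof.
have [cs csi sK siK] := full_group_inv_funP s.
have [ct cti tK tiK] := full_group_inv_funP t.
apply/mem_set; split.
  exists (full_group_inv_fun t \o full_group_inv_fun s); split.
  - by move=> x; apply: continuous_comp; [exact: ct|exact: cs].
  - by move=> x; apply: continuous_comp; [exact: csi|exact: cti].
  - by move=> x /=; rewrite sK tK.
  - by move=> x /=; rewrite tiK siK.
have [[k l] /= [ck cl kl]] := full_group_cocycles t.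
have [[k' l'] /= [ck' cl' kl']] := full_group_cocycles s.
exists ((fun x => k x + (k' \o full_group_fun t) x)%N,
        (fun x => (l' \o full_group_fun t) x + l x)%N); split => /=.
- by apply: continuous_natD => //; exact: continuous_nat_comp.
- by apply: continuous_natD => //; exact: continuous_nat_comp.
- by move=> x; rewrite iterD kl' -iterD addnC iterD kl -iterD.
Qed.

Lemma full_group_inv_subproof (t : full_group) : full_group_inv_fun t \in full_group_set.
Proof.
have [ct cti tK tiK] := full_group_inv_funP t.
apply/mem_set; split; first by exists (full_group_fun t).
have [[k l] /= [ck cl kl]] := full_group_cocycles t.
exists (l \o full_group_inv_fun t, k \o full_group_inv_fun t); split => /=.
- exact: continuous_nat_comp.
- exact: continuous_nat_comp.
- by move=> x; rewrite -kl tiK.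
Qed.

Definition full_group_one : full_group :=
  exist (fun t => t \in full_group_set) _ full_group_one_subproof.
Definition full_group_mul (s t : full_group) : full_group :=
  exist (fun t => t \in full_group_set) _ (full_group_mul_subproof s t).
Definition full_group_inv (t : full_group) : full_group :=
  exist (fun t => t \in full_group_set) _ (full_group_inv_subproof t).

Lemma full_group_mulA : associative full_group_mul.
Proof. by move=> s t u; apply: full_group_inj. Qed.

Lemma full_group_mul1 : left_id full_group_one full_group_mul.
Proof. by move=> s; apply: full_group_inj. Qed.

Lemma full_group_1mul : right_id full_group_one full_group_mul.
Proof. by move=> s; apply: full_group_inj. Qed.

Lemma full_group_mulV : left_inverse full_group_one full_group_inv full_group_mul.
Proof.
by move=> s; apply: full_group_inj => x; have [_ _ sK _] := full_group_inv_funP s;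
  exact: sK.
Qed.

Lemma full_group_Vmul : right_inverse full_group_one full_group_inv full_group_mul.
Proof.
by move=> s; apply: full_group_inj => x; have [_ _ _ sK] := full_group_inv_funP s;
  exact: sK.
Qed.

HB.instance Definition _ := isGroup.Build full_group
  full_group_mulA full_group_mul1 full_group_1mul full_group_mulV full_group_Vmul.

(* [rho_cocycle f] uses one choice of the pair (k, l) for every element of
   [full_group]. *)
Definition full_group_kl (t : full_group) :
    (markov_shift A -> nat) * (markov_shift A -> nat) :=
  projT1 (cid (full_group_cocycles t)).

Definition rho_cocycle (f : markov_shift A -> int)
    (p : markov_shift A * full_group) : int :=
  birkhoff f ((full_group_kl p.2).2 p.1) p.1
  - birkhoff f ((full_group_kl p.2).1 p.1) (full_group_fun p.2 p.1).

Definition cocycle_subgroup (f : markov_shift A -> int) : set full_group :=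
  [set t | forall x, rho_cocycle f (x, t) = 0].

End FullGroup.

(** * The first cohomology group *)

Section Cohomology.
Context {N : nat}.
Variable A : 'M[nat]_N.

Definition Z1_set : set (markov_shift A * full_group A -> int) :=
  [set r |
     continuous_int
       (r : markov_shift A * discrete_topology (full_group A) -> int) /\
     forall x (t1 t2 : full_group A),
       r (x, (t2 * t1)%g) = r (x, t1) + r (full_group_fun t1 x, t2)].

Definition Z1_pred : {pred markov_shift A * full_group A -> int} :=
  fun r => `[< Z1_set r >].

Let continuous_intP (T : topologicalType) (f : T -> int) :
  continuous_int f <-> forall x, nbhs x [set y | f y = f x].
Proof.
split=> [cf x|H x].
  by apply: (cf x [set f x]); exact: (@discrete_set1 (discrete_topology int)).
by apply/(@discrete_cvg (discrete_topology int)); exact: H.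
Qed.

Lemma Z1_zmod_closed : zmod_closed Z1_pred.
Proof.
split=> [|r s /asboolP[cr rM] /asboolP[cs sM]]; apply/asboolP; split.
- by apply/continuous_intP => x; apply: filterS filterT.
- by move=> x t1 t2; rewrite addr0.
- apply/continuous_intP => x; move/continuous_intP/(_ x): cr => cr.
  move/continuous_intP/(_ x): cs => cs.
  by apply: filterS2 cr cs => y /= ry sy; rewrite /GRing.add /= /GRing.opp /= ry sy.
- move=> x t1 t2.
  have E (p : markov_shift A * full_group A) : (r - s) p = r p - s p by [].
  by rewrite !E rM sM opprD addrACA.
Qed.

HB.instance Definition _ :=
  GRing.isZmodClosed.Build (markov_shift A * full_group A -> int) Z1_pred Z1_zmod_closed.

Record Z1 := MkZ1 {
  Z1_val : markov_shift A * full_group A -> int;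
  _ : Z1_pred Z1_val
}.

HB.instance Definition _ := [isSub for Z1_val].
HB.instance Definition _ := [Choice of Z1 by <:].
HB.instance Definition _ := [SubChoice_isSubZmodule of Z1 by <:].

Definition B1_pred : {pred Z1} := fun r =>
  `[< exists g : markov_shift A -> int, continuous_int g /\
        forall x (t : full_group A),
          \val r (x, t) = g x - g (full_group_fun t x) >].

Lemma B1_zmod_closed : zmod_closed B1_pred.
Proof.
split=> [|r s /asboolP[g [cg gE]] /asboolP[h [ch hE]]]; apply/asboolP.
  exists (cst 0); split; last by move=> x t; rewrite subr0.
  by apply/continuous_intP => x; apply: filterS filterT.
exists (fun x => g x - h x); split.
  apply/continuous_intP => x; move/continuous_intP/(_ x): cg => cg.
  move/continuous_intP/(_ x): ch => ch.
  by apply: filterS2 cg ch => y /= -> ->.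
move=> x t; rewrite raddfB /=.
have E (u v : markov_shift A * full_group A -> int) p : (u - v) p = u p - v p by [].
by rewrite E gE hE !opprD !opprK addrACA.
Qed.

HB.instance Definition _ :=
  GRing.isZmodClosed.Build Z1 B1_pred B1_zmod_closed.

Definition H1 : zmodType := Quotient.quot (B1_pred : zmodClosed Z1).

(* The class of a function that is not in [Z1] is 0 by convention;
   [rho_cocycle f] lies in [Z1] when [f] is continuous and [A] is an
   irreducible non-permutation 0-1 matrix. *)
Definition H1_class (r : markov_shift A * full_group A -> int) : H1 :=
  \pi_H1%qT (insubd (0 : Z1) r).

End Cohomology.

(** * Cuntz-Krieger algebras and generalized gauge actions *)

Section CuntzKrieger.
Context {R : realType} {N : nat}.
Variable A : 'M[nat]_N.

Definition CK_family (U : cstarAlgType R) (S : 'I_N -> U) : Prop :=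
  [/\ forall i, S i * cstar (S i) * S i = S i,
      \sum_j S j * cstar (S j) = 1
    & forall i, cstar (S i) * S i = \sum_j (S j * cstar (S j)) *+ A i j].

(* [U], with generators [S], is the universal C*-algebra of the relations
   [CK_family]; this determines (U, S) up to a unique isomorphism. *)
Definition is_CK_algebra (U : cstarAlgType R) (S : 'I_N -> U) : Prop :=
  [/\ CK_family S,
      cstar_generated (range S) = setT
    & forall (V : cstarAlgType R) (T : 'I_N -> V), CK_family T ->
        exists phi : {lrmorphism U -> V},
          star_morphism phi /\ forall i, phi (S i) = T i].

Definition admissible (mu : seq 'I_N) : bool :=
  sorted (fun i j => A i j == 1%N) mu.

Section Generators.
Context {U : cstarAlgType R}.
Variable S : 'I_N -> U.

Definition S_word (mu : seq 'I_N) : U := \prod_(i <- mu) S i.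

Definition S_proj (mu : seq 'I_N) : U := S_word mu * cstar (S_word mu).

Definition CK_diagonal : set U :=
  cstar_generated [set S_proj mu | mu in [set mu | admissible mu]].

Definition expC (theta : R) : R[i] := (cos theta +i* sin theta)%C.

(* A list [s] of pairs (f_i, mu(i)) represents [f] if f = \sum_i f_i 1_mu(i)
   and \sum_i S_mu(i) S_mu(i)^* = 1. *)
Definition cylinder_sum (s : seq (int * seq 'I_N)) (f : markov_shift A -> int) : Prop :=
  [/\ all (fun p => admissible p.2) s,
      forall x, f x = \sum_(p <- s) p.1 *+ in_cylinder p.2 x
    & \sum_(p <- s) S_proj p.2 = 1].

(* The value does not depend on the representation of [f]; a representation
   exists whenever [f] is continuous. *)
Definition exp_unitary (f : markov_shift A -> int) (t : R) : U :=
  xget 0 [set u | exists s, cylinder_sum s f /\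
    u = \sum_(p <- s) expC (2 * pi * p.1%:~R * t) *: S_proj p.2].

Definition gauge_automorphism (f : markov_shift A -> int) (t : R) (a : U -> U) :
    Prop :=
  exists phi : {lrmorphism U -> U},
    [/\ a = phi, star_morphism phi, bijective phi
      & forall j, phi (S j) = exp_unitary f t * S j].

(* [t : R] represents a class in R/Z.  For continuous [f] (and [A] and [S] as
   in [is_CK_algebra]) the automorphism exists, is unique since the [S j]
   generate, and depends only on the class of [t] in R/Z. *)
Definition gauge_action (f : markov_shift A -> int) (t : R) : U -> U :=
  xget (idfun : U -> U) [set a | gauge_automorphism f t a].

End Generators.
End CuntzKrieger.

(* Main.v *)
Require Import Defs.
From HB Require Import structures.
From mathcomp Require Import all_boot all_order all_algebra.
From mathcomp Require Import perm complex.
From mathcomp Require Import all_classical all_reals all_analysis.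
From mathcomp Require Import zify ring lra.

(* Conjugation by h carries the full group of A to that of B. Because the
   shift spaces have no isolated points, the lag l - k of an orbit cocycle is
   determined by the map, so rho^f does not depend on the choice of (k, l);
   telescoping the cocycles of h along orbits then gives
   rho^(Psi_h f)(x, tau) = rho^f(h x, h tau h^-1), hence (ii) and (iii).

   For (i), the *-algebra generated by the S_i acts on the space of all
   functions on the shift, with S_i acting by g |-> 1_[i] (g o sigma), and this
   action is faithful: V S_mu is a combination of creation words S_nu when mu is
   long, and such combinations are separated by aperiodic points. Hence an
   identity in the algebra may be checked on functions. Conjugating the action of
   S_i by h gives an operator that, by compactness, is a finite sum of operators
   S_nu S_eta^* of B, which defines the image of S_i. Star-morphisms are bounded,
   so that two of them agree as soon as they agree on generators. *)

Set Implicit Arguments.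
Unset Strict Implicit.
Unset Printing Implicit Defensive.

Import Order.TTheory GRing.Theory Num.Theory.
Import numFieldNormedType.Exports.

Local Open Scope classical_set_scope.
Local Open Scope ring_scope.

(** * Norms and star-morphisms of C*-algebras *)

Section CStarNorm.
Context {R : realType} {U : cstarAlgType R}.
Implicit Types x y z : U.

(** The algebras are known only through relations, a norm and a universal property, and this shapes
    the proof. The relations ask the range projections to sum to 1 but do not list their
    orthogonality. It is derived from norm estimates alone: a projection is an extreme point among
    the self-adjoint elements of the unit ball of its corner. Boundedness of star-morphisms is
    obtained in the same spirit, by completing a small self-adjoint element to a unitary with a
    square root built by iteration.

    Functions on the shift carry no inner product, so the adjoint of an operator cannot be read off
    the operator. For this reason [rep] records both, and it is a relation generated by the algebra
    operations, so that no well-definedness has to be proved. Admitting all functions makes the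
    indicator of a single point available as a test function.

    Universality gives existence of morphisms only. Their bijectivity comes from running the same
    construction for the inverse homeomorphism, or for the opposite time in the case of the gauge
    action, and comparing on generators. *)

Lemma cnorm0 : cnorm (0 : U) = 0.
Proof. by rewrite -(scale0r (0 : U)) cnormZ Normc.normc0 mul0r. Qed.

Lemma cnormZr (r : R) x : cnorm (r%:C%C *: x) = `|r| * cnorm x.
Proof.
rewrite cnormZ; congr (_ * _).
by rewrite /Normc.normc /= expr0n /= addr0 sqrtr_sqr.
Qed.

Lemma cnormN x : cnorm (- x) = cnorm x.
Proof. by rewrite -scaleN1r -(rmorph1 (real_complex R)) -rmorphN cnormZr normrN1 mul1r. Qed.

Lemma cnorm_ge0 x : 0 <= cnorm x.
Proof.
have := cnormD x (- x); rewrite subrr cnorm0 cnormN -mulr2n.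
by rewrite pmulrn_lge0.
Qed.

Lemma cnormB x y : cnorm (x - y) <= cnorm x + cnorm y.
Proof. by rewrite -(cnormN y); exact: cnormD. Qed.

Lemma cnorm_distC x y : cnorm (x - y) = cnorm (y - x).
Proof. by rewrite -opprB cnormN. Qed.

Lemma cstar0 : cstar (0 : U) = 0.
Proof. by apply: (addrI (cstar 0)); rewrite -cstarD !addr0. Qed.

Lemma cstarN x : cstar (- x) = - cstar x.
Proof. by apply: (addrI (cstar x)); rewrite -cstarD !subrr cstar0. Qed.

Lemma cstarB x y : cstar (x - y) = cstar x - cstar y.
Proof. by rewrite cstarD cstarN. Qed.

Lemma cstar1 : cstar (1 : U) = 1.
Proof.
have /(congr1 cstar) : cstar (1 : U) * 1 = cstar 1 by rewrite mulr1.
by rewrite cstarM cstarK mulr1.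
Qed.

Lemma cstarZr (r : R) x : cstar (r%:C%C *: x) = r%:C%C *: cstar x.
Proof. by rewrite cstarZ conjc_real. Qed.

Lemma cnorm_gt0 x : x != 0 -> 0 < cnorm x.
Proof.
move=> x0; rewrite lt_neqAle cnorm_ge0 andbT eq_sym.
by apply: contra_neq x0; exact: cnorm_eq0.
Qed.

Lemma cnorm_star x : cnorm (cstar x) = cnorm x.
Proof.
have le z : cnorm z <= cnorm (cstar z).
  have [->|z0] := eqVneq z 0; first by rewrite cstar0.
  by rewrite -(ler_pM2r (cnorm_gt0 z0)) -expr2 -cnorm_cstar cnormM.
by apply/eqP; rewrite eq_le le -{2}(cstarK x) le.
Qed.

Lemma cnorm1 : cnorm (1 : U) = 1.
Proof.
have n1 : cnorm (1 : U) != 0 by rewrite gt_eqF// cnorm_gt0// oner_neq0.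
by apply: (mulIf n1); rewrite mul1r -expr2 -cnorm_cstar cstar1 mulr1.
Qed.

Lemma cnorm_sqr_selfadj x : cstar x = x -> cnorm (x * x) = cnorm x ^+ 2.
Proof. by move=> xx; rewrite -cnorm_cstar xx. Qed.

Lemma cnorm_proj_le1 x : cstar x = x -> x * x = x -> cnorm x <= 1.
Proof.
move=> xs xx; have [->|x0] := eqVneq x 0; first by rewrite cnorm0 ler01.
by rewrite -(ler_pM2r (cnorm_gt0 x0)) -expr2 -cnorm_sqr_selfadj// xx mul1r.
Qed.

Lemma cnorm_isometry x : cstar x * x = 1 -> cnorm x = 1.
Proof.
move=> xx; apply/eqP; rewrite -(@eqrXn2 _ 2)//; last exact: cnorm_ge0.
by rewrite -cnorm_cstar xx cnorm1 expr1n.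
Qed.

Lemma cstar_mul_eq0 x : cstar x * x = 0 -> x = 0.
Proof.
move=> xx; apply: cnorm_eq0; apply/eqP.
by rewrite -sqrf_eq0 -cnorm_cstar xx cnorm0.
Qed.

Definition tends (u : nat -> U) (l : U) :=
  forall e : R, 0 < e -> exists n0, forall n, (n0 <= n)%N -> cnorm (u n - l) < e.

Lemma tendsP u l :
  tends u l <-> (fun n => cnorm (u n - l)) @ \oo --> (0 : R).
Proof.
split=> [H|H e e0].
  apply/cvgrPdist_lt => e e0; have [n0 H0] := H e e0.
  exists n0 => // n /= nn; rewrite sub0r normrN ger0_norm ?cnorm_ge0//.
  exact: H0.
move/cvgrPdist_lt/(_ e e0) : H => [n0 _ H]; exists n0 => n nn.
by have := H n nn; rewrite /= sub0r normrN ger0_norm ?cnorm_ge0.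
Qed.

Lemma cnorm_le_eq0 x (C : R) : (forall e : R, 0 < e -> cnorm x <= C * e) -> x = 0.
Proof.
move=> H; apply: cnorm_eq0; apply/eqP; rewrite eq_le cnorm_ge0 andbT.
apply/ler_addgt0Pr => e e0; rewrite add0r.
have C0 : 0 < `|C| + 1 by rewrite ltr_wpDl.
apply: (le_trans (H (e / (`|C| + 1)) (divr_gt0 e0 C0))).
rewrite mulrA ler_pdivrMr// mulrC ler_pM2l// (le_trans (ler_norm _))//.
by rewrite lerDl.
Qed.

End CStarNorm.

(* With [c := (a^2 + c^2) / 2] obtained by iteration, [b := 1 - c] is a square
   root of [1 - a^2]. *)
Section SquareRoot.
Context {R : realType} {U : cstarAlgType R}.
Variable a : U.
Hypothesis a_sa : cstar a = a.
Hypothesis a_le : cnorm a <= 2^-1.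

Let half (x : U) : U := (2^-1 : R)%:C%C *: x.

Fixpoint sqrt_iter (n : nat) : U :=
  if n is n'.+1 then half (a * a + sqrt_iter n' * sqrt_iter n') else 0.

Let cnorm_half x : cnorm (half x) = 2^-1 * cnorm x.
Proof. by rewrite cnormZr ger0_norm// invr_ge0. Qed.

Let half_double x : half x + half x = x.
Proof.
rewrite -scalerDl -rmorphD /= -mulr2n.
suff -> : (2^-1 : R) *+ 2 = 1 by rewrite rmorph1 scale1r.
by rewrite -[LHS]mulr_natr mulVf// pnatr_eq0.
Qed.

Lemma sqrt_iter_le n : cnorm (sqrt_iter n) <= 2^-1.
Proof.
elim: n => [|n IH] /=; first by rewrite cnorm0 invr_ge0.
rewrite cnorm_half; have := cnormD (a * a) (sqrt_iter n * sqrt_iter n).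
have := cnormM a a; have := cnormM (sqrt_iter n) (sqrt_iter n).
have := cnorm_ge0 a; have := cnorm_ge0 (sqrt_iter n).
move: a_le IH; set p := cnorm a; set q := cnorm (sqrt_iter n).
set s := cnorm _; set t := cnorm _; set w := cnorm _.
move=> p1 q1 q0 p0 sq tp wst.
have : q * q <= 2^-1 * 2^-1 by apply: ler_pM.
have : p * p <= 2^-1 * 2^-1 by apply: ler_pM.
by move=> *; lra.
Qed.

Lemma sqrt_iter_sa n : cstar (sqrt_iter n) = sqrt_iter n.
Proof.
elim: n => [|n IH] /=; first exact: cstar0.
by rewrite cstarZr cstarD !cstarM a_sa IH.
Qed.

Lemma sqrt_iter_comm n : a * sqrt_iter n = sqrt_iter n * a.
Proof.
elim: n => [|n IH] /=; first by rewrite mul0r mulr0.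
rewrite -scalerAr -scalerAl mulrDl mulrDr mulrA; congr (_ *: (_ + _)).
by rewrite mulrA IH -mulrA IH mulrA.
Qed.

(** The iterated map contracts by 1/2 on the ball of radius 1/2, because x^2 - y^2 = x (x - y) + (x
    - y) y holds without commutativity. *)
Lemma cnorm_half_sqrB x y : cnorm x <= 2^-1 -> cnorm y <= 2^-1 ->
  cnorm (half (a * a + x * x) - half (a * a + y * y)) <= 2^-1 * cnorm (x - y).
Proof.
move=> x1 y1; rewrite -scalerBr cnorm_half ler_pM2l ?invr_gt0//.
have -> : a * a + x * x - (a * a + y * y) = x * (x - y) + (x - y) * y.
  by rewrite mulrBr mulrBl addrA subrK opprD addrACA subrr add0r.
apply: (le_trans (cnormD _ _)).
have := cnormM x (x - y); have := cnormM (x - y) y.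
have : cnorm x * cnorm (x - y) <= 2^-1 * cnorm (x - y).
  by rewrite ler_wpM2r// cnorm_ge0.
have : cnorm (x - y) * cnorm y <= cnorm (x - y) * 2^-1.
  by rewrite ler_wpM2l// cnorm_ge0.
by move=> *; lra.
Qed.

Lemma sqrt_iter_step n : cnorm (sqrt_iter n.+1 - sqrt_iter n) <= 2^-1 ^+ n.
Proof.
elim: n => [|n IH].
  by rewrite subr0 expr0 (le_trans (sqrt_iter_le 1))// invf_le1// ler1n.
apply: (le_trans (cnorm_half_sqrB (sqrt_iter_le n.+1) (sqrt_iter_le n))).
by rewrite exprS ler_pM2l// invr_gt0.
Qed.

Lemma sqrt_iter_cauchy n k :
  cnorm (sqrt_iter (n + k) - sqrt_iter n) <= 2 * 2^-1 ^+ n - 2 * 2^-1 ^+ (n + k).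
Proof.
elim: k => [|k IH]; first by rewrite addn0 !subrr cnorm0.
rewrite addnS.
have -> : sqrt_iter (n + k).+1 - sqrt_iter n =
  (sqrt_iter (n + k).+1 - sqrt_iter (n + k)) + (sqrt_iter (n + k) - sqrt_iter n).
  by rewrite addrA subrK.
have := cnormD (sqrt_iter (n + k).+1 - sqrt_iter (n + k))
               (sqrt_iter (n + k) - sqrt_iter n).
have := sqrt_iter_step (n + k); rewrite exprS.
by move: IH => *; lra.
Qed.

Lemma sqrt_1Bsqr : exists b : U,
  [/\ cstar b = b, a * b = b * a & a * a + b * b = 1].
Proof.
have [|c /tendsP cvc] := @cnorm_complete R U sqrt_iter.
  move=> e e0.
  have : (fun n => 2 * (2^-1 : R) ^+ n) @ \oo --> (2 * 0 : R).
    apply: cvgM; first exact: cvg_cst.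
    by apply: cvg_expr; rewrite ger0_norm ?invr_ge0// invf_lt1// ltr1n.
  rewrite mulr0 => /cvgrPdist_lt/(_ e e0)[n0 _ H]; exists n0.
  have main m n : (n0 <= m)%N -> (m <= n)%N -> cnorm (sqrt_iter n - sqrt_iter m) < e.
    move=> nm mn; have := sqrt_iter_cauchy m (n - m); rewrite subnKC// => h.
    have := H m nm; rewrite /= sub0r normrN ger0_norm; last first.
      by rewrite mulr_ge0// exprn_ge0// invr_ge0.
    have : 0 <= 2 * (2^-1 : R) ^+ n by rewrite mulr_ge0// exprn_ge0// invr_ge0.
    by move=> *; lra.
  move=> m n nm nn; have [mn|/ltnW nm'] := leqP m n; last exact: main.
  by rewrite cnorm_distC; exact: main.
have cs : cstar c = c.
  apply/eqP; rewrite -subr_eq0; apply/eqP.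
  apply: (@cnorm_le_eq0 _ _ _ 2) => e e0; have [n0 /(_ n0 (leqnn _)) H] := cvc e e0.
  have -> : cstar c - c = (sqrt_iter n0 - c) - cstar (sqrt_iter n0 - c).
    by rewrite cstarB sqrt_iter_sa opprB [RHS]addrC addrA subrK.
  by apply: (le_trans (cnormB _ _)); rewrite cnorm_star; lra.
have ca : a * c = c * a.
  apply/eqP; rewrite -subr_eq0; apply/eqP.
  apply: (@cnorm_le_eq0 _ _ _ 1) => e e0; have [n0 /(_ n0 (leqnn _)) H] := cvc e e0.
  have -> : a * c - c * a = (sqrt_iter n0 - c) * a - a * (sqrt_iter n0 - c).
    by rewrite mulrBl mulrBr sqrt_iter_comm opprB [RHS]addrC addrA subrK.
  apply: (le_trans (cnormB _ _)).
  have := cnormM (sqrt_iter n0 - c) a; have := cnormM a (sqrt_iter n0 - c).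
  have : cnorm a * cnorm (sqrt_iter n0 - c) <= 2^-1 * cnorm (sqrt_iter n0 - c).
    by rewrite ler_wpM2r// cnorm_ge0.
  by rewrite [cnorm (_ - _) * cnorm a]mulrC => *; lra.
have c1 : cnorm c <= 2^-1.
  apply/ler_addgt0Pr => e e0; have [n0 /(_ n0 (leqnn _)) H] := cvc e e0.
  have -> : c = sqrt_iter n0 - (sqrt_iter n0 - c) by rewrite opprB [RHS]addrC subrK.
  apply: (le_trans (cnormB _ _)); have := sqrt_iter_le n0.
  by move=> *; lra.
have cc : c = half (a * a + c * c).
  apply/eqP; rewrite -subr_eq0; apply/eqP.
  apply: (@cnorm_le_eq0 _ _ _ 2) => e e0; have [n0 H] := cvc e e0.
  have H0 := H n0 (leqnn _); have H1 := H n0.+1 (leqnSn _).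
  have -> : c - half (a * a + c * c) =
    (sqrt_iter n0.+1 - half (a * a + c * c)) - (sqrt_iter n0.+1 - c).
    by rewrite opprB [RHS]addrC addrA subrK.
  apply: (le_trans (cnormB _ _)).
  have := cnorm_half_sqrB (sqrt_iter_le n0) c1.
  move: H1; rewrite [sqrt_iter n0.+1]/=.
  by have := cnorm_ge0 (sqrt_iter n0 - c); move=> *; lra.
exists (1 - c); split.
- by rewrite cstarB cstar1 cs.
- by rewrite mulrBr mulrBl mulr1 mul1r ca.
- rewrite mulrBr mulr1 mulrBl mul1r.
  have e : a * a + c * c = c + c by rewrite {3 4}cc half_double.
  have -> : a * a = c + c - c * c by rewrite -e addrK.
  by rewrite -[c + c - _]addrA -[1 - c - _]addrA -opprD [LHS]addrC subrK.
Qed.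

End SquareRoot.

(** * Boundedness of star-morphisms *)

Section StarMorphism.
Context {R : realType} {U V : cstarAlgType R}.

Lemma conj_i : ('i%C : R[i])^*%C = - 'i%C.
Proof. by apply/eqP; rewrite eq_complex /= oppr0 !eqxx. Qed.

Lemma scalei_sqr (x : V) : 'i%C *: ('i%C *: x) = - x.
Proof. by rewrite scalerA -expr2 sqr_i scaleN1r. Qed.

(* [y + i z] is unitary. *)
Lemma cnorm_le1_of_sqr (y z : V) : cstar y = y -> cstar z = z ->
  y * z = z * y -> y * y + z * z = 1 -> cnorm y <= 1.
Proof.
move=> ys zs yz yz1.
have isom s : cstar s = s -> y * s = s * y -> s * s = z * z ->
    cnorm (y + 'i%C *: s) = 1.
  move=> ss ys' sz; apply: cnorm_isometry.
  rewrite cstarD cstarZ ys ss conj_i scaleNr mulrDr !mulrBl.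
  rewrite -!scalerAl -!scalerAr ys' scalei_sqr opprK.
  by rewrite addrA subrK sz.
have u1 : cnorm (y + 'i%C *: z) = 1 by exact: isom.
have v1 : cnorm (y + 'i%C *: (- z)) = 1.
  by apply: isom; rewrite ?cstarN ?zs// ?mulrN ?mulNr ?opprK// yz.
(* 2y is the sum of the unitaries y + iz and y - iz. *)
have := cnormD (y + 'i%C *: z) (y + 'i%C *: (- z)).
rewrite u1 v1 scalerN addrACA subrr addr0.
have -> : y + y = (2 : R)%:C%C *: y by rewrite rmorph_nat scaler_nat mulr2n.
by rewrite cnormZr ger0_norm// => ?; lra.
Qed.

Variable phi : {lrmorphism U -> V}.
Hypothesis phiS : star_morphism phi.

(** Rescaled to norm 1/2, the element x becomes the real part a of a unitary a + ib, and [phi]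
    preserves the identities that make it one. The factor 2 reflects that the square root was built
    for norm at most 1/2; for continuity any constant will do. *)
Lemma star_morphism_sa_le (x : U) : cstar x = x -> cnorm (phi x) <= 2 * cnorm x.
Proof.
move=> xs; have [->|x0] := eqVneq x 0; first by rewrite raddf0 cnorm0 cnorm0 mulr0.
have x1 := cnorm_gt0 x0.
pose r : R := (2 * cnorm x)^-1.
have r0 : 0 < r by rewrite invr_gt0 mulr_gt0.
pose a := r%:C%C *: x.
have as_ : cstar a = a by rewrite cstarZr xs.
have [|b [bs ab ab1]] := sqrt_1Bsqr as_.
  by rewrite cnormZr gtr0_norm// /r invfM -mulrA mulVf ?mulr1// gt_eqF.
have : cnorm (phi a) <= 1.
  apply: (@cnorm_le1_of_sqr _ (phi b)).
  - by rewrite -phiS as_.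
  - by rewrite -phiS bs.
  - by rewrite -!rmorphM ab.
  - by rewrite -!rmorphM -rmorphD ab1 rmorph1.
by rewrite linearZ /= cnormZr gtr0_norm// ler_pdivrMl ?mulr1// mulr_gt0.
Qed.

(** The C*-identity reduces the bound to the self-adjoint element x^* x. *)
Lemma star_morphism_le (x : U) : cnorm (phi x) <= 2 * cnorm x.
Proof.
have := @star_morphism_sa_le (cstar x * x).
rewrite cstarM cstarK rmorphM /= phiS !cnorm_cstar => /(_ erefl) h.
have := cnorm_ge0 x; have := cnorm_ge0 (phi x); move: h.
set p := cnorm (phi x); set q := cnorm x => h p0 q0.
rewrite -(@ler_pXn2r _ 2)// ?nnegrE ?mulr_ge0// exprMn (le_trans h)//.
by rewrite ler_wpM2r ?sqr_ge0// -natrX ler_nat.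
Qed.

Lemma tends_star_morphism (u : nat -> U) l :
  tends u l -> tends (phi \o u) (phi l).
Proof.
move=> ul e e0; have [|n0 H] := ul (e / 2); first by rewrite divr_gt0.
exists n0 => n /H; rewrite /= -raddfB ltr_pdivlMr// mulrC.
exact: le_lt_trans (star_morphism_le _).
Qed.

End StarMorphism.

Lemma tends_unique {R : realType} {U : cstarAlgType R} (u : nat -> U) (l l' : U) :
  tends u l -> tends u l' -> l = l'.
Proof.
move=> ul ul'; apply/eqP; rewrite -subr_eq0; apply/eqP.
apply: (@cnorm_le_eq0 _ _ _ 2) => e e0.
have [n0 H] := ul e e0; have [n1 H'] := ul' e e0.
have := H (maxn n0 n1) (leq_maxl _ _); have := H' (maxn n0 n1) (leq_maxr _ _).
set x := u _ => h1 h2.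
have -> : l - l' = (x - l') - (x - l) by rewrite opprB [RHS]addrC addrA subrK.
by apply: (le_trans (cnormB _ _)); lra.
Qed.

Lemma cstar_subalgebra_preimage {R : realType} {U V : cstarAlgType R}
  (phi : {lrmorphism U -> V}) (D : set V) : star_morphism phi ->
  cstar_subalgebra D -> cstar_subalgebra (phi @^-1` D).
Proof.
move=> phiS [D0 DZ DM DS DL]; split => /=.
- by rewrite raddf0.
- by move=> a x y Dx Dy; rewrite linearP; exact: DZ.
- by move=> x y Dx Dy; rewrite rmorphM; exact: DM.
- by move=> x Dx; rewrite phiS; exact: DS.
- move=> u l Du /tendsP ul; apply: (DL (phi \o u)) => //.
  by apply/tendsP; exact: tends_star_morphism.
Qed.

Lemma cstar_subalgebra_generated {R : realType} {U : cstarAlgType R} (G : set U) :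
  cstar_subalgebra (cstar_generated G).
Proof.
split.
- by move=> D [[]].
- by move=> a x y Gx Gy D DG; have [[_ DZ _ _ _] _] := DG; apply: DZ; [exact: Gx|exact: Gy].
- by move=> x y Gx Gy D DG; have [[_ _ DM _ _] _] := DG; apply: DM; [exact: Gx|exact: Gy].
- by move=> x Gx D DG; have [[_ _ _ DS _] _] := DG; apply: DS; exact: Gx.
- move=> u l Gu ul D DG; have [[_ _ _ _ DL] _] := DG.
  by apply: DL ul => n; exact: Gu.
Qed.

Lemma sub_cstar_generated {R : realType} {U : cstarAlgType R} (G : set U) :
  G `<=` cstar_generated G.
Proof. by move=> x Gx D [_]; exact. Qed.

Lemma cstar_generated_min {R : realType} {U : cstarAlgType R} (G D : set U) :
  cstar_subalgebra D -> G `<=` D -> cstar_generated G `<=` D.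
Proof. by move=> SD GD x; apply. Qed.

Lemma star_morphism_eq {R : realType} {U V : cstarAlgType R}
  (phi psi : {lrmorphism U -> V}) (G : set U) :
  star_morphism phi -> star_morphism psi -> cstar_generated G = setT ->
  (forall x, G x -> phi x = psi x) -> phi =1 psi.
Proof.
move=> phiS psiS GT H x.
have : cstar_generated G x by rewrite GT.
apply: (@cstar_generated_min _ _ _ [set x | phi x = psi x]) => //; split => /=.
- by rewrite !raddf0.
- by move=> a y z yE zE; rewrite !linearP /= yE zE.
- by move=> y z yE zE; rewrite !rmorphM /= yE zE.
- by move=> y yE; rewrite phiS psiS yE.
- move=> u l uE /tendsP ul; have := tends_star_morphism psiS ul.
  have -> : psi \o u = phi \o u by apply/funext => n /=; rewrite uE.
  by apply: tends_unique; exact: tends_star_morphism.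
Qed.

(** * Extremality of a projection in its corner, and orthogonality of projections that sum to 1 *)

Section Corner.
Context {R : realType} {U : cstarAlgType R}.
Variable p : U.
Hypothesis p_sa : cstar p = p.
Hypothesis p_idem : p * p = p.

(** Polynomials of degree at most 3 in [t], with [p] as the unit. Identities between them reduce to
    identities between four complex coefficients. *)
Let cubic (t : U) (a b c d : R[i]) : U :=
  a *: p + b *: t + c *: (t * t) + d *: (t * t * t).

Let cubicD t a b c d a' b' c' d' :
  cubic t a b c d + cubic t a' b' c' d' = cubic t (a + a') (b + b') (c + c') (d + d').
Proof.
rewrite /cubic !scalerDl [LHS]addrACA; congr (_ + _).
rewrite [LHS]addrACA; congr (_ + _).
by rewrite [LHS]addrACA.
Qed.

Let cubicZ t k a b c d :
  k *: cubic t a b c d = cubic t (k * a) (k * b) (k * c) (k * d).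
Proof. by rewrite /cubic !scalerDr !scalerA. Qed.

Let cubic_mul t (z a b c : R[i]) : p * t = t -> t * p = t ->
  cubic t a b c 0 * (p + z *: t) = cubic t a (a * z + b) (b * z + c) (c * z).
Proof.
move=> pt tp; rewrite /cubic scale0r addr0 !mulrDr !mulrDl -!scalerAl -!scalerAr.
rewrite -!mulrA !tp p_idem pt !scalerA !scalerDl !mulrA.
rewrite -!addrA; congr (_ + _).
rewrite (addrCA (c *: _) ((a * z) *: t)) (addrCA (b *: t) ((a * z) *: t)).
by rewrite (addrCA (c *: _) ((b * z) *: (t * t))).
Qed.

Let cubic_lin t z : p + z *: t = cubic t 1 z 0 0.
Proof. by rewrite /cubic !scale0r !addr0 scale1r. Qed.

Let cubic_sqr t z w : p * t = t -> t * p = t ->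
  (p + z *: t) * (p + w *: t) = cubic t 1 (w + z) (z * w) 0.
Proof. by move=> pt tp; rewrite (cubic_lin t z) cubic_mul// mul0r addr0 mul1r. Qed.

Let cubic_cube t z : p * t = t -> t * p = t ->
  (p + z *: t) * (p + z *: t) * (p + z *: t) =
  cubic t 1 (3 * z) (3 * z ^+ 2) (z ^+ 3).
Proof.
move=> pt tp; rewrite cubic_sqr// cubic_mul//.
by congr (cubic t _ _ _ _); ring.
Qed.

Let cnormM_le1 (x y : U) : cnorm x <= 1 -> cnorm y <= 1 -> cnorm (x * y) <= 1.
Proof.
by move=> x1 y1; rewrite (le_trans (cnormM _ _))// mulr_ile1// cnorm_ge0.
Qed.

Let cnorm_conv3 (x y z : U) (a b c : R) : 0 <= a -> 0 <= b -> 0 <= c ->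
  cnorm x <= 1 -> cnorm y <= 1 -> cnorm z <= 1 ->
  cnorm (a%:C%C *: x + b%:C%C *: y + c%:C%C *: z) <= a + b + c.
Proof.
move=> a0 b0 c0 x1 y1 z1.
apply: (le_trans (cnormD _ _)); apply: lerD; first apply: (le_trans (cnormD _ _)).
  by apply: lerD; rewrite cnormZr ger0_norm// ler_piMr.
by rewrite cnormZr ger0_norm// ler_piMr.
Qed.

(* For [z = (3 + 6i)/11] one has [z^2 + z'^2 = z^3 + z'^3 = -54/121], [z'] the
   conjugate, so the terms of degree 2 and 3 cancel in
   [54 (p + t)^3 + 121 (p + zt)^3 + 121 (p + z't)^3 = 296 p + 360 t]. *)
Lemma corner_gain t : cstar t = t -> p * t = t -> t * p = t ->
  cnorm (p + t) <= 1 -> cnorm (p - t) <= 1 ->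
  cnorm (p + (45 / 37 : R)%:C%C *: t) <= 1.
Proof.
move=> ts pt tp t1 t2.
have p1 : cnorm p <= 1 by exact: cnorm_proj_le1.
(* The square of this norm is the norm of p + t^2, the average of (p + t)^2 and (p - t)^2. *)
have i1 : cnorm (p + 'i%C *: t) <= 1.
  rewrite -(@ler_pXn2r _ 2)// ?nnegrE ?cnorm_ge0// expr1n -cnorm_cstar.
  rewrite cstarD cstarZ p_sa ts conj_i cubic_sqr//.
  have -> : cubic t 1 ('i%C - 'i%C) (- 'i%C * 'i%C) 0 =
      (2^-1 : R)%:C%C *: ((p + 1 *: t) * (p + 1 *: t)) +
      (2^-1 : R)%:C%C *: ((p + (-1) *: t) * (p + (-1) *: t)) + (0 : R)%:C%C *: p.
    rewrite !cubic_sqr// scale0r addr0 !cubicZ cubicD.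
    congr (cubic t _ _ _ _); apply/eqP; rewrite eq_complex /=;
      by apply/andP; split; apply/eqP; field.
  apply: (le_trans (cnorm_conv3 _ _ _ _ _ p1)); rewrite ?invr_ge0//.
  - by rewrite scale1r; exact: cnormM_le1.
  - by rewrite scaleN1r; exact: cnormM_le1.
  - by lra.
have Ni1 : cnorm (p + (- 'i%C) *: t) <= 1.
  have conjNi : (- 'i%C : R[i])^*%C = 'i%C by rewrite -conj_i conjcK.
  by rewrite -cnorm_star cstarD cstarZ p_sa ts conjNi.
(* A convex combination with weights 2/11, 3/11 and 6/11 of p, p + t and p + wt; for w = i and w =
   -i it yields the two conjugate points used below. *)
have half z (w : R[i]) : cnorm (p + w *: t) <= 1 ->
    z = (3 / 11)%:C%C + (6 / 11)%:C%C * w -> cnorm (p + z *: t) <= 1.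
  move=> w1 zE.
  have -> : p + z *: t = (2 / 11 : R)%:C%C *: p + (3 / 11 : R)%:C%C *: (p + 1 *: t) +
      (6 / 11 : R)%:C%C *: (p + w *: t).
    have -> : p = p + 0 *: t by rewrite scale0r addr0.
    rewrite -!addrA -!scalerDl !add0r !cubic_lin !cubicZ !cubicD zE.
    by congr (cubic t _ _ _ _); rewrite ?mulr0 ?addr0// ?mulr1 ?add0r//
      -!rmorphD -(rmorph1 (real_complex R)); congr (_%:C%C); field.
  apply: (le_trans (cnorm_conv3 _ _ _ p1 _ w1)); rewrite ?scale1r//.
  by lra.
pose z : R[i] := (3 / 11 +i* (6 / 11))%C.
pose z' : R[i] := (3 / 11 +i* (- (6 / 11)))%C.
have z1 : cnorm (p + z *: t) <= 1.
  apply: (half _ 'i%C i1); apply/eqP; rewrite eq_complex /=.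
  by apply/andP; split; apply/eqP; field.
have z1' : cnorm (p + z' *: t) <= 1.
  apply: (half _ (- 'i%C) Ni1); apply/eqP; rewrite eq_complex /=.
  by apply/andP; split; apply/eqP; field.
have -> : p + (45 / 37 : R)%:C%C *: t =
    (54 / 296 : R)%:C%C *: ((p + 1 *: t) * (p + 1 *: t) * (p + 1 *: t)) +
    (121 / 296 : R)%:C%C *: ((p + z *: t) * (p + z *: t) * (p + z *: t)) +
    (121 / 296 : R)%:C%C *: ((p + z' *: t) * (p + z' *: t) * (p + z' *: t)).
  rewrite !cubic_cube// !cubicZ !cubicD cubic_lin.
  congr (cubic t _ _ _ _); apply/eqP; rewrite eq_complex /=;
    by apply/andP; split; apply/eqP; field.
apply: (le_trans (cnorm_conv3 _ _ _ _ _ _)).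
1-3: by lra.
- by rewrite scale1r; do 2?apply: cnormM_le1.
- by do 2?apply: cnormM_le1.
- by do 2?apply: cnormM_le1.
- by lra.
Qed.

(** The hypotheses pass from t to (45/37) t by [corner_gain], applied to t and to -t. Hence
    (45/37)^n t has norm at most 2 for every n, which forces t = 0. *)
Lemma corner_extreme t : cstar t = t -> p * t = t -> t * p = t ->
  cnorm (p + t) <= 1 -> cnorm (p - t) <= 1 -> t = 0.
Proof.
move=> ts pt tp t1 t2.
have p1 : cnorm p <= 1 by exact: cnorm_proj_le1.
pose r : R := 45 / 37.
have r0 : 0 < r by rewrite divr_gt0.
have H n : cnorm (p + (r ^+ n)%:C%C *: t) <= 1 /\ cnorm (p - (r ^+ n)%:C%C *: t) <= 1.
  elim: n => [|n [IH1 IH2]]; first by rewrite expr0 rmorph1 scale1r.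
  have q1 : p * ((r ^+ n)%:C%C *: t) = (r ^+ n)%:C%C *: t by rewrite -scalerAr pt.
  have q2 : ((r ^+ n)%:C%C *: t) * p = (r ^+ n)%:C%C *: t by rewrite -scalerAl tp.
  split.
    rewrite exprS rmorphM -scalerA; apply: corner_gain => //.
    by rewrite cstarZr ts.
  rewrite exprS rmorphM -scalerA -scalerN; apply: corner_gain.
  - by rewrite cstarN cstarZr ts.
  - by rewrite mulrN q1.
  - by rewrite mulNr q2.
  - by [].
  - by rewrite opprK.
apply: (@cnorm_le_eq0 _ _ _ 2) => e e0.
have : (fun n => (r^-1 : R) ^+ n) @ \oo --> (0 : R).
  apply: cvg_expr; rewrite ger0_norm ?invr_ge0 ?(ltW r0)// invf_lt1//.
  by rewrite /r; lra.
move=> /cvgrPdist_lt/(_ e e0)[n _ /(_ n (leqnn n))] /=.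
rewrite sub0r normrN ger0_norm ?exprn_ge0 ?invr_ge0 ?(ltW r0)// exprVn => rn.
have [h _] := H n.
have : cnorm ((r ^+ n)%:C%C *: t) <= 2.
  have -> : (r ^+ n)%:C%C *: t = (p + (r ^+ n)%:C%C *: t) - p by rewrite addrC addKr.
  by apply: (le_trans (cnormB _ _)); lra.
rewrite cnormZr gtr0_norm ?exprn_gt0// -ler_pdivlMl ?exprn_gt0// => /le_trans; apply.
by rewrite mulrC ler_pM2l// ltW.
Qed.

End Corner.

Lemma cnorm_sum {R : realType} {U : cstarAlgType R} (I : Type) (r : seq I)
  (P : pred I) (F : I -> U) :
  cnorm (\sum_(i <- r | P i) F i) <= \sum_(i <- r | P i) cnorm (F i).
Proof.
elim/big_ind2 : _ => [|x a y b xa yb|i _]; rewrite ?cnorm0//.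
exact: le_trans (cnormD _ _) (lerD xa yb).
Qed.

(* The compressions [p_i p_k p_i], [k <> i], are positive and add up to 0. *)
Lemma projections_orthogonal {R : realType} {U : cstarAlgType R} (I : finType)
  (p : I -> U) : (forall i, cstar (p i) = p i) -> (forall i, p i * p i = p i) ->
  \sum_i p i = 1 -> forall i j, i != j -> p i * p j = 0.
Proof.
move=> ps pp p1 i j ij.
pose q k := p i * p k * p i.
pose t k := (2 : R)%:C%C *: q k.
have qs k : cstar (q k) = q k by rewrite !cstarM !ps mulrA.
have pt k : p i * t k = t k by rewrite -scalerAr /q !mulrA pp.
have tp k : t k * p i = t k by rewrite -scalerAl /t /q -!mulrA pp.
have ts k : cstar (t k) = t k by rewrite cstarZr qs.
have t2 k : t k = q k *+ 2 by rewrite /t rmorph_nat scaler_nat.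
have pi1 : cnorm (p i) <= 1 by exact: cnorm_proj_le1.
(* This bound stands in for positivity of [q k]. It holds because the element is the compression by
   [p i] of the reflection 1 - 2 [p k], which has norm 1. *)
have pt1 k : cnorm (p i - t k) <= 1.
  have -> : p i - t k = p i * (1 - p k *+ 2) * p i.
    by rewrite mulrBr mulrBl mulr1 pp t2 /q mulrnAr mulrnAl.
  have u1 : cnorm (1 - p k *+ 2) = 1.
    apply: cnorm_isometry; rewrite cstarB cstar1 mulr2n cstarD ps.
    have : (p k + p k) * (p k + p k) = (p k + p k) + (p k + p k).
      by rewrite mulrDl mulrDr pp.
    move: (p k + p k) => x xx.
    by rewrite mulrBl mul1r mulrBr mulr1 xx opprB [x + x - x]addrK subrK.
  rewrite (le_trans (cnormM _ _))// mulr_ile1 ?cnorm_ge0//.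
  by rewrite (le_trans (cnormM _ _))// u1 mulr1.
have sumt : \sum_(k | (k != i) && (k != j)) t k = - t j.
  have : \sum_k q k = p i.
    by rewrite -big_distrl -big_distrr /= p1 mulr1 pp.
  rewrite (bigD1 i)//= /q !pp => /(canRL (addKr _)); rewrite addNr.
  rewrite (bigD1 j) ?(eq_sym j i)//= -/(q j) => /eqP; rewrite addr_eq0 => /eqP qj.
  by rewrite -scaler_sumr /t qj scalerN opprK; congr (_ *: _); apply: eq_bigl => k.
pose m : R := \sum_(k | (k != i) && (k != j)) 1.
have m0 : 0 <= m by apply: sumr_ge0.
(* Here [m] counts the indices other than i and j. As their [t k] add up to -[t j], the left side is
   the sum of the m elements [p i - t k], each in the unit ball. *)
have mt : cnorm (m%:C%C *: p i + t j) <= m.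
  have -> : m%:C%C *: p i + t j = \sum_(k | (k != i) && (k != j)) (p i - t k).
    rewrite big_split/= sumrN sumt opprK; congr (_ + _).
    rewrite /m rmorph_sum/= scaler_suml; apply: eq_bigr => k _.
    by rewrite rmorph1 scale1r.
  by apply: (le_trans (cnorm_sum _ _ _)); apply: ler_sum.
have c0 : 0 < (m + 1)^-1 by rewrite invr_gt0 ltr_wpDl.
have cc : (m + 1)^-1 * (m + 1) = 1 by rewrite mulVf// gt_eqF// ltr_wpDl.
have split_p : p i = ((m + 1)^-1)%:C%C *: (m%:C%C *: p i + p i).
  by rewrite -{3}(scale1r (p i)) -scalerDl scalerA -(rmorph1 (real_complex R)) -rmorphD
    -rmorphM cc rmorph1 scale1r.
(* Both signs of this perturbation of [p i] stay in the unit ball: (m + 1) p_i + t_j = (m p_i + t_j)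
   + p_i and (m + 1) p_i - t_j = m p_i + (p_i - t_j), each of norm at most m + 1. *)
have : ((m + 1)^-1)%:C%C *: t j = 0.
  apply: (@corner_extreme _ _ (p i)) => //.
  - by rewrite cstarZr ts.
  - by rewrite -scalerAr pt.
  - by rewrite -scalerAl tp.
  - rewrite {1}split_p -scalerDr cnormZr gtr0_norm//
      ler_pdivrMl ?mulr1; last by rewrite ltr_wpDl.
    rewrite addrAC; apply: (le_trans (cnormD _ _)); lra.
  - rewrite {1}split_p -scalerBr cnormZr gtr0_norm//
      ler_pdivrMl ?mulr1; last by rewrite ltr_wpDl.
    rewrite -addrA; apply: (le_trans (cnormD _ _)); apply: lerD => //.
    by rewrite cnormZr ger0_norm// ler_piMr.
move=> /(congr1 (fun x => (m + 1)%:C%C *: x)).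
rewrite scaler0 scalerA -rmorphM mulrC cc rmorph1 scale1r => tj0.
have qj0 : q j = 0.
  move/(congr1 (fun x => (2^-1 : R)%:C%C *: x)): tj0.
  by rewrite scaler0 scalerA -rmorphM mulVf ?pnatr_eq0// rmorph1 scale1r.
have : p j * p i = 0.
  by apply: cstar_mul_eq0; rewrite cstarM !ps mulrA -(mulrA (p i)) pp.
by move=> /(congr1 cstar); rewrite cstarM !ps cstar0.
Qed.

(** * Shift spaces *)

Lemma continuous_int_nbhs (T : topologicalType) (f : T -> int) :
  continuous_int f <-> forall x, nbhs x [set y | f y = f x].
Proof.
split=> [cf x|H x].
  by apply: (cf x [set f x]); exact: (@discrete_set1 (discrete_topology int)).
by apply/(@discrete_cvg (discrete_topology int)); exact: H.
Qed.

Lemma continuous_nat_nbhs (T : topologicalType) (f : T -> nat) :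
  continuous f <-> forall x, nbhs x [set y | f y = f x].
Proof.
split=> [cf x|H x]; first by apply: (cf x [set f x]); exact: discrete_set1.
by apply/discrete_cvg; exact: H.
Qed.

(** * Cylinders, locally constant functions and compactness *)

Section ShiftTopology.
Context {N : nat} {A : 'M[nat]_N}.
Local Notation X := (markov_shift A).

Definition agree (m : nat) (x y : X) := forall i, (i < m)%N -> val x i = val y i.

Lemma agree_sym m x y : agree m x y -> agree m y x.
Proof. by move=> xy i im; rewrite xy. Qed.

Lemma agree_trans m x y z : agree m x y -> agree m y z -> agree m x z.
Proof. by move=> xy yz i im; rewrite xy// yz. Qed.

Lemma agree_le m n x y : (m <= n)%N -> agree n x y -> agree m x y.
Proof. by move=> mn xy i im; apply: xy; exact: leq_trans mn. Qed.

Lemma agreeP m x y : mkseq (val x) m = mkseq (val y) m <-> agree m x y.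
Proof.
split=> [xy i im|xy]; last by apply/eq_in_map => i; rewrite mem_iota => /xy.
by rewrite -(nth_mkseq (val x i) (val x) im) xy nth_mkseq.
Qed.

Lemma markov_eq (x y : X) : (forall i, val x i = val y i) -> x = y.
Proof. by move=> xy; apply: val_inj; apply/funext. Qed.

Lemma iter_sigmaE n (x : X) i : val (iter n sigma x) i = val x (n + i)%N.
Proof. by elim: n i => [|n IH] i //=; rewrite IH addSnnS. Qed.

Lemma markovP (x : X) n : A (val x n) (val x n.+1) = 1%N.
Proof. exact: (set_mem (valP x)). Qed.

Definition mkpoint (u : nat -> 'I_N) (Au : forall n, A (u n) (u n.+1) = 1%N) : X :=
  exist (fun y => y \in markov_set A) u (mem_set (Au : markov_set A u)).

Let seq_filter (u : nat -> 'I_N) : set_system (nat -> 'I_N) :=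
  [set V | exists m, forall v, (forall i, (i < m)%N -> u i = v i) -> V v].

Let seq_filter_filter u : Filter (seq_filter u).
Proof.
split; first by exists 0%N.
- move=> P Q [m Pm] [n Qn]; exists (maxn m n) => v uv; split.
  + by apply: Pm => i im; apply: uv; rewrite leq_max im.
  + by apply: Qn => i im; apply: uv; rewrite leq_max im orbT.
- by move=> P Q PQ [m Pm]; exists m => v /Pm /PQ.
Qed.

(** The filter generated by the cylinders around [val x] converges to it in each coordinate, hence
    in the product topology. Every neighbourhood therefore belongs to that filter. *)
Lemma nbhs_cylinder (x : X) (V : set X) :
  nbhs x V -> exists m, forall y, agree m x y -> V y.
Proof.
move=> [_ [[W oW <-] Wx sub]].
have FF := seq_filter_filter (val x).
have cvF : seq_filter (val x) -->
    (val x : prod_topology (fun _ : nat => discrete_topology 'I_N)).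
  apply/cvg_sup => i B; rewrite nbhsE => -[C [[D oD <-] Dx] CB].
  by exists i.+1 => v /(_ i (ltnSn i)) xv; apply: CB => /=; rewrite -xv.
have [m Wm] : seq_filter (val x) W by apply: cvF; exact: open_nbhs_nbhs.
by exists m => y xy; apply: sub; exact: Wm.
Qed.

Lemma cylinder_nbhs (x : X) m : nbhs x [set y | agree m x y].
Proof.
elim: m => [|m IH].
  by apply: filterS filterT => y _ i.
have : nbhs x [set y : X | val x m = val y m].
  have c : continuous ((fun u : prod_topology (fun _ : nat => discrete_topology 'I_N)
      => u m) \o (val : X -> _)).
    move=> y; apply: continuous_comp; first exact: initial_continuous.
    exact: proj_continuous.
  apply: (c x [set i | val x m = i]).
  have e : [set i | val x m = i] = [set val x m] :> set 'I_N.
    by apply/seteqP; split=> i /=.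
  by rewrite e; exact: (@discrete_set1 (discrete_topology 'I_N)).
apply: filterS2 IH => y /= xy xm i; rewrite ltnS leq_eqVlt => /orP[/eqP->//|].
exact: xy.
Qed.

Definition locally_constant (T : Type) (f : X -> T) :=
  forall x, exists m, forall y, agree m x y -> f y = f x.

Lemma continuous_intP (f : X -> int) : continuous_int f <-> locally_constant f.
Proof.
rewrite continuous_int_nbhs; split=> cf x; first exact: nbhs_cylinder (cf x).
have [m H] := cf x; exact: filterS (cylinder_nbhs x m).
Qed.

Lemma continuous_natP (f : X -> nat) : continuous f <-> locally_constant f.
Proof.
rewrite continuous_nat_nbhs; split=> cf x; first exact: nbhs_cylinder (cf x).
have [m H] := cf x; exact: filterS (cylinder_nbhs x m).
Qed.

Lemma mkseq_in_cylinder (x : X) m : in_cylinder (mkseq (val x) m) x.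
Proof. by rewrite /in_cylinder size_mkseq. Qed.

(* Koenig's lemma: a cylinder on which no modulus works has a one-letter
   extension on which no modulus works. *)
Lemma locally_constant_uniform (T : Type) (f : X -> T) :
  locally_constant f -> exists m, forall x y, agree m x y -> f y = f x.
Proof.
move=> cf.
pose good w := exists m, forall x y : X,
  in_cylinder w x -> agree m x y -> f y = f x.
suff [m H] : good [::] by exists m => x y; exact: H.
apply: contrapT => bad0.
have bad_pt w : ~ good w -> exists x : X, in_cylinder w x.
  move=> bw; apply: contrapT => nx; apply: bw; exists 0%N => x y xw.
  by case: nx; exists x.
(* This point only supplies a default letter, for the words that are good. *)
have [x0 _] := bad_pt _ bad0.
have step w : exists i, ~ good w -> ~ good (rcons w i).
  have [gw|bw] := pselect (good w); first by exists (val x0 0%N).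
  apply: contrapT => ni.
  have gi i : good (rcons w i) by apply: contrapT => bi; apply: ni; exists i.
  have [m Hm] := choice gi.
  apply: bw; exists (maxn (size w).+1 (\max_i m i)) => x y xw xy.
  have xwi : in_cylinder (rcons w (val x (size w))) x.
    by rewrite /in_cylinder size_rcons mkseqS (eqP xw).
  apply: Hm xwi (agree_le _ xy).
  by rewrite leq_max leq_bigmax orbT.
have [g Hg] := choice step.
pose w n := iter n (fun w => rcons w (g w)) [::].
have bw n : ~ good (w n) by elim: n => // n IH; exact: Hg.
have wE n : w n = mkseq (g \o w) n by elim: n => // n IH; rewrite mkseqS -IH.
have ptw n : exists x : X, mkseq (val x) n = mkseq (g \o w) n.
  have [x] := bad_pt _ (bw n); rewrite /in_cylinder wE size_mkseq => /eqP xn.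
  by exists x.
(* The limit of the bad words is a point of the shift: each of its prefixes is also the prefix of an
   actual point, since a word with empty cylinder is good. *)
have Aw n : A ((g \o w) n) ((g \o w) n.+1) = 1%N.
  have [x xn] := ptw n.+2.
  have xi i : (i < n.+2)%N -> val x i = (g \o w) i.
    by move=> i2; rewrite -(nth_mkseq (val x i) (val x) i2) xn nth_mkseq.
  by rewrite -!xi// markovP.
pose x := mkpoint Aw.
have [m Hm] := cf x; apply: (bw m); exists m => y z.
rewrite /in_cylinder wE size_mkseq => /eqP/(@agreeP m y x) yx yz.
have xy : agree m x y := agree_sym yx.
by rewrite (Hm y xy) (Hm z (agree_trans xy yz)).
Qed.

End ShiftTopology.

(** * Paths, branching and aperiodic points of an irreducible non-permutation matrix *)

Section Irreducible.
Context {N : nat} {A : 'M[nat]_N}.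
Local Notation X := (markov_shift A).
Hypothesis A01 : zero_one_mx A.
Hypothesis Airr : irreducible_mx A.
Hypothesis Aperm : ~~ is_perm_mx A.

Lemma expr_mx_gt0 n i j : (0 < (A ^+ n.+1) i j)%N ->
  exists2 k, A i k = 1%N & (0 < (A ^+ n) k j)%N.
Proof.
rewrite exprS -mulmxE mxE => H; apply: contrapT => nk.
move: H; rewrite big1 // => k _; case: (A01 i k) => Aik; rewrite Aik ?mul0r// mul1r.
by apply/eqP; rewrite -leqn0 leqNgt; apply/negP => kj; apply: nk; exists k.
Qed.

Lemma successor_ex i : exists j, A i j = 1%N.
Proof. by have [n /expr_mx_gt0[k Aik _]] := Airr i i; exists k. Qed.

Lemma predecessor_ex j : exists i, A i j = 1%N.
Proof.
have [n] := Airr j j; elim: n {1}j => [|n IH] i /expr_mx_gt0[k Aik]; last exact: IH.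
rewrite expr0 mxE; have [<- _|//] := eqVneq k j; by exists i.
Qed.

Lemma point_at i : exists x : X, val x 0%N = i.
Proof.
have [s As] := choice successor_ex.
by exists (@mkpoint _ A (fun n => iter n s i) (fun n => As _)).
Qed.

Lemma cons_ex i (y : X) : A i (val y 0%N) = 1%N ->
  exists2 z : X, val z 0%N = i & sigma z = y.
Proof.
move=> Ay.
have H n : A (if n is n'.+1 then val y n' else i) (val y n) = 1%N.
  by case: n => // n; exact: markovP.
exists (@mkpoint _ A (fun n => if n is n'.+1 then val y n' else i) H) => //.
exact: markov_eq.
Qed.

Lemma prepend_ex m (x y : X) : val x m = val y 0%N ->
  exists2 z, agree m x z & iter m sigma z = y.
Proof.
elim: m x => [|m IH] x xy; first by exists y.
have [|z xz zy] := IH (sigma x); first by [].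
have [|w w0 wz] := @cons_ex (val x 0%N) z.
  case: m xz zy xy {IH} => [_ /= -> <-|m xz _ _]; first exact: markovP.
  by rewrite -xz//; exact: markovP.
exists w; last by rewrite iterSr wz.
case=> [_|i im]; first by rewrite w0.
by have := xz i im; rewrite -wz.
Qed.

Lemma reach_ex n i j (y : X) : (0 < (A ^+ n.+1) i j)%N -> val y 0%N = j ->
  exists2 z : X, val z 0%N = i & iter n.+1 sigma z = y.
Proof.
elim: n i => [|n IH] i /expr_mx_gt0[k Aik kj] yj.
  move: kj; rewrite expr0 mxE; case: (eqVneq k j) => // kj _.
  by apply: cons_ex; rewrite yj -kj.
have [z z0 zy] := IH k kj yj.
have [|w w0 wz] := @cons_ex i z; first by rewrite z0.
by exists w => //; rewrite iterSr wz.
Qed.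

(** Without branching, [A] is the matrix of a self-map of the letters. Every letter has a
    predecessor, so this map is onto, hence a permutation. *)
Lemma branching_ex : exists b c d, [/\ A b c = 1%N, A b d = 1%N & c <> d].
Proof.
apply: contrapT => nb; move/negP: Aperm; apply.
have [s As] := choice successor_ex.
have sP i j : A i j = 1%N -> j = s i.
  by move=> Aij; apply: contrapT => js; apply: nb; exists i, j, (s i).
have sI : injective s.
  have /image_injP sI : #|codom s| == #|'I_N|.
    apply/eqP/eq_card => j; rewrite [RHS]inE; apply/codomP.
    by have [i /sP ->] := predecessor_ex j; exists i.
  by move=> i j; exact: sI.
apply/is_perm_mxP; exists (perm sI); apply/matrixP => i j; rewrite !mxE permE.
have [<-|sij] := eqVneq (s i) j; first exact: As.
by case: (A01 i j) => // /sP jE; rewrite jE eqxx in sij.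
Qed.

(** After m letters of x, follow a path to a branching letter and continue in either of two ways; at
    most one of the resulting points is x. *)
Lemma not_isolated (x : X) m : exists2 y, agree m x y & y <> x.
Proof.
have [b [c [d [Abc Abd cd]]]] := branching_ex.
have [n nb] := Airr (val x m) b.
have pt e : A b e = 1%N -> exists2 z : X, agree m x z & val (iter (m + n.+1) sigma z) 1%N = e.
  move=> Abe; have [y0 y0e] := point_at e.
  have [|y yb yy0] := @cons_ex b y0; first by rewrite y0e.
  have [z zx zy] := reach_ex nb yb.
  have [w xw wz] := prepend_ex (esym zx).
  exists w => //.
  by rewrite addnC iterD wz zy -y0e -yy0.
have [z1 xz1 z1c] := pt c Abc; have [z2 xz2 z2d] := pt d Abd.
have [z1x|z1x] := pselect (z1 = x); last by exists z1.
by exists z2 => // z2x; apply: cd; rewrite -z1c -z2d z1x z2x.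
Qed.

(** The claim is made for a whole cylinder around y, so that moving y inside it to exclude the
    period n + 1 cannot bring back a period excluded before. *)
Lemma aperiodic_cylinder n (x : X) m : exists (y : X) m', agree m x y /\
  forall z, agree m' y z -> forall k, (0 < k <= n)%N -> iter k sigma z <> z.
Proof.
elim: n => [|n [y [m' [xy ym']]]].
  by exists x, 0%N; split=> // z _ k; case: k.
have [y' yy' ny'] : exists2 y', agree (maxn m m') y y' & iter n.+1 sigma y' <> y'.
  have [yp|] := pselect (iter n.+1 sigma y = y); last by exists y.
  have [y' yy' ny'] := not_isolated y (maxn (maxn m m') n.+1).
  (* Two points of period n + 1 that agree on n + 1 letters are equal. *)
  exists y'; first by apply: agree_le yy'; rewrite leq_max leqnn.
  move=> yp'; apply: ny'; apply: markov_eq => i.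
  have [k] := ubnP i; elim: k i => // k IH i ik.
  have [im|im] := ltnP i n.+1.
    by rewrite -yy'// leq_max im orbT.
  by rewrite -(subnKC im) -!iter_sigmaE yp yp'; apply: IH; lia.
have [i yi] : exists i, val y' (n.+1 + i)%N <> val y' i.
  apply: contrapT => H; apply: ny'; apply: markov_eq => i.
  by rewrite iter_sigmaE; apply: contrapT => yi; apply: H; exists i.
(* n + 2 + i letters include those at i and n + 1 + i, where [y'] breaks the period n + 1. *)
exists y', (maxn m' (n.+2 + i)); split.
  by apply: agree_trans xy _; apply: agree_le yy'; rewrite leq_maxl.
move=> z y'z k /andP[k0]; rewrite leq_eqVlt => /orP[/eqP -> zp|kn].
  have yz j : (j < n.+2 + i)%N -> val y' j = val z j.
    by move=> ji; apply: y'z; rewrite leq_max ji orbT.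
  by apply: yi; rewrite !yz; [rewrite -(iter_sigmaE n.+1) zp|lia|lia].
apply: (ym' z); last by rewrite k0.
apply: agree_trans (agree_le (leq_maxr m m') yy') _.
by apply: agree_le y'z; rewrite leq_maxl.
Qed.

Lemma aperiodic_ex n (x : X) m : exists2 y, agree m x y &
  forall k, (0 < k <= n)%N -> iter k sigma y <> y.
Proof.
by have [y [m' [xy H]]] := aperiodic_cylinder n x m; exists y => //; exact: H.
Qed.

(* The cocycle exponent [l - k] is locally constant and determined by the map:
   otherwise some cylinder would consist of eventually periodic points with the
   same period, and so be a single point. *)
Lemma lag_unique (tau : X -> X) (k l k' l' : X -> nat) (x : X) :
  locally_constant k -> locally_constant l ->
  locally_constant k' -> locally_constant l' ->
  (forall x, iter (k x) sigma (tau x) = iter (l x) sigma x) ->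
  (forall x, iter (k' x) sigma (tau x) = iter (l' x) sigma x) ->
  (l x + k' x = l' x + k x)%N.
Proof.
move=> ck cl ck' cl' kl kl'.
have [m1 H1] := ck x; have [m2 H2] := cl x.
have [m3 H3] := ck' x; have [m4 H4] := cl' x.
pose m := maxn (maxn m1 m2) (maxn m3 m4).
have E z : agree m x z ->
    iter (l x + k' x) sigma z = iter (l' x + k x) sigma z.
  move=> xz.
  have kz : k z = k x by apply: H1; apply: agree_le xz; rewrite !leq_max leqnn.
  have lz : l z = l x by apply: H2; apply: agree_le xz; rewrite !leq_max leqnn orbT.
  have kz' : k' z = k' x by apply: H3; apply: agree_le xz; rewrite !leq_max leqnn !orbT.
  have lz' : l' z = l' x by apply: H4; apply: agree_le xz; rewrite !leq_max leqnn !orbT.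
  rewrite -kz -lz -kz' -lz' addnC iterD -kl -iterD.
  by rewrite [in RHS]addnC [RHS]iterD -kl' -iterD addnC.
move: E; move: (l x + k' x)%N (l' x + k x)%N => p q E.
wlog pq : p q E / (p < q)%N.
  move=> H; have [pq|qp|//] := ltngtP p q; first exact: H.
  by apply/esym; apply: H => // z xz; rewrite E.
have [y xy yx] := not_isolated x (maxn m q).
exfalso; apply: yx; apply: markov_eq => i.
have Em z : agree m x z -> forall j, val z (p + j)%N = val z (q + j)%N.
  by move=> /E zE j; rewrite -!iter_sigmaE zE.
have xm : agree m x y by apply: agree_le xy; rewrite leq_maxl.
have [n] := ubnP i; elim: n i => // n IH i ni.
have [iq|qi] := ltnP i q; first by rewrite xy// leq_max iq orbT.
rewrite -(subnKC qi) -!Em//; apply: IH; lia.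
Qed.

End Irreducible.

(** * Orbit equivalence, full groups and cohomology *)

Section Birkhoff.
Context {N : nat} {A : 'M[nat]_N}.
Local Notation X := (markov_shift A).
Implicit Types (f : X -> int) (x y z : X).

Lemma birkhoffD f m n x :
  birkhoff f (m + n) x = birkhoff f m x + birkhoff f n (iter m sigma x).
Proof.
rewrite /birkhoff big_split_ord /=; congr (_ + _).
by apply: eq_bigr => i _; rewrite addnC iterD.
Qed.

Lemma tail_trans x y z k l k' l' :
  iter k sigma x = iter l sigma y -> iter k' sigma y = iter l' sigma z ->
  iter (k + k') sigma x = iter (l' + l) sigma z.
Proof.
move=> xy yz; rewrite addnC iterD xy -iterD addnC iterD yz -iterD.
by rewrite addnC.
Qed.

(** Two points with equal tails, together with the shifts matching them, form an arrow of the
    groupoid of the shift. The difference of Birkhoff sums is a cocycle there: it adds up under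
    composition. The proof splits the sum of length l + k' at y in its two orders. *)
Lemma birkhoff_trans f x y z k l k' l' :
  iter k sigma x = iter l sigma y -> iter k' sigma y = iter l' sigma z ->
  birkhoff f (l' + l) z - birkhoff f (k + k') x =
  (birkhoff f l' z - birkhoff f k' y) + (birkhoff f l y - birkhoff f k x).
Proof.
move=> xy yz; rewrite !birkhoffD xy -yz.
have := birkhoffD f l k' y; have := birkhoffD f k' l y.
by rewrite addnC => ->; lia.
Qed.

(** Lengthening both orbit segments by the same number of steps adds the same terms to both sums,
    once the tails agree. Only the lag l - k matters. *)
Lemma birkhoff_lag f x y k l k' l' :
  iter k sigma x = iter l sigma y -> iter k' sigma x = iter l' sigma y ->
  (l + k' = l' + k)%N ->
  birkhoff f l y - birkhoff f k x = birkhoff f l' y - birkhoff f k' x.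
Proof.
move=> xy xy' lk.
have := birkhoffD f l k' y; have := birkhoffD f l' k y.
rewrite -lk => -> /eqP; rewrite -xy -xy'.
have := birkhoffD f k k' x; have := birkhoffD f k' k x.
by rewrite addnC => ->; lia.
Qed.

End Birkhoff.

Section LocallyConstant.
Context {N : nat} {A : 'M[nat]_N}.
Local Notation X := (markov_shift A).

Lemma locally_constant_cst (T : Type) (c : T) : locally_constant (fun _ : X => c).
Proof. by move=> x; exists 0%N. Qed.

Lemma locally_constant2 (T1 T2 T : Type) (op : T1 -> T2 -> T) (f : X -> T1) (g : X -> T2) :
  locally_constant f -> locally_constant g -> locally_constant (fun x => op (f x) (g x)).
Proof.
move=> cf cg x; have [m Hm] := cf x; have [n Hn] := cg x.
exists (maxn m n) => y xy.
by rewrite Hm ?Hn//; apply: agree_le xy; rewrite leq_max leqnn ?orbT.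
Qed.

Lemma locally_constant_diag (I T : Type) (i : X -> I) (F : I -> X -> T) :
  locally_constant i -> (forall j, locally_constant (F j)) ->
  locally_constant (fun x => F (i x) x).
Proof.
move=> ci cF x; have [m Hm] := ci x; have [n Hn] := cF (i x) x.
exists (maxn m n) => y xy.
by rewrite Hm ?Hn//; apply: agree_le xy; rewrite leq_max leqnn ?orbT.
Qed.

Lemma continuous_agreeP {M : nat} {B : 'M[nat]_M} (h : X -> markov_shift B) :
  continuous h <-> forall n, locally_constant (fun x => mkseq (val (h x)) n).
Proof.
split=> [ch n x|H x V /nbhs_cylinder[n Vn]].
  have [m H] := nbhs_cylinder (ch x _ (cylinder_nbhs (h x) n)).
  by exists m => y /H/agreeP.
have [m Hm] := H n x; apply: filterS (cylinder_nbhs x m) => y xy.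
by apply: Vn; apply/agreeP/esym/Hm.
Qed.

Lemma locally_constant_comp {M : nat} {B : 'M[nat]_M} (T : Type)
  (h : X -> markov_shift B) (f : markov_shift B -> T) :
  continuous h -> locally_constant f -> locally_constant (f \o h).
Proof.
move=> /continuous_agreeP ch cf x; have [n Hn] := cf (h x).
by have [m Hm] := ch n x; exists m => y /Hm/esym/agreeP/Hn.
Qed.

Lemma sigma_continuous : continuous (sigma : X -> X).
Proof.
apply/continuous_agreeP => n x; exists n.+1 => y xy.
by apply/esym/agreeP => i im; exact: xy.
Qed.

Lemma iter_sigma_continuous n : continuous (iter n sigma : X -> X).
Proof.
elim: n => [|n IH] x; first exact: cvg_id.
by apply: continuous_comp; [exact: IH|exact: sigma_continuous].
Qed.

Lemma birkhoff_locally_constant (f : X -> int) n :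
  locally_constant f -> locally_constant (birkhoff f n).
Proof.
move=> cf; elim: n => [|n IH].
  by move=> x; exists 0%N => y _; rewrite /birkhoff !big_ord0.
have -> : birkhoff f n.+1 = fun x => birkhoff f n x + (f \o iter n sigma) x.
  by apply/funext => x; rewrite /birkhoff big_ord_recr.
apply: locally_constant2 IH _.
exact: locally_constant_comp (@iter_sigma_continuous n) cf.
Qed.

End LocallyConstant.

(** * Telescoping the orbit cocycles and conjugating the full group *)

Section OrbitEquivalenceCocycle.
Context {N M : nat} {A : 'M[nat]_N} {B : 'M[nat]_M}.
Variables (h : markov_shift A -> markov_shift B) (k l : markov_shift A -> nat).
Hypothesis ch : continuous h.
Hypothesis coe : orbit_cocycles h k l.

Lemma orbit_cocycles_lc : locally_constant k /\ locally_constant l.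
Proof. by have [/continuous_natP ck /continuous_natP cl _] := coe. Qed.

Lemma Psi_map_continuous f : continuous_int f -> continuous_int (Psi_map h k l f).
Proof.
have [ck cl] := orbit_cocycles_lc.
move=> /continuous_intP cf; apply/continuous_intP.
apply: (@locally_constant2 _ _ _ _ _ (fun a b : int => a - b)).
  apply: (locally_constant_diag (F := fun n x => birkhoff f n (h x))) cl _ => n.
  exact: locally_constant_comp ch (birkhoff_locally_constant n cf).
apply: (locally_constant_diag (F := fun n x => birkhoff f n (h (sigma x)))) ck _ => n.
apply: (@locally_constant_comp _ _ _ _ _ (h \o sigma)).
  by move=> x; apply: continuous_comp; [exact: sigma_continuous|exact: ch].
exact: birkhoff_locally_constant.
Qed.

(** Composes the n arrows that link the images under [h] of successive points of an orbit. The
    exponents are chosen before [f], so one pair serves every function. *)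
Lemma Psi_map_birkhoff n : exists kl : markov_shift A -> nat * nat,
  [/\ locally_constant (fst \o kl), locally_constant (snd \o kl) & forall x,
    iter (kl x).1 sigma (h (iter n sigma x)) = iter (kl x).2 sigma (h x) /\
    forall f, birkhoff (Psi_map h k l f) n x =
      birkhoff f (kl x).2 (h x) - birkhoff f (kl x).1 (h (iter n sigma x))].
Proof.
have [ck cl] := orbit_cocycles_lc; have [_ _ hkl] := coe.
elim: n => [|n [kl [ckl1 ckl2 IH]]].
  exists (fun _ => (0%N, 0%N)); split; try exact: locally_constant_cst.
  by move=> x; split=> // f; rewrite /birkhoff !big_ord0.
exists (fun x => (k (iter n sigma x) + (kl x).1, (kl x).2 + l (iter n sigma x)))%N; split.
- apply: (@locally_constant2 _ _ _ _ _ addn) => //.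
  exact: locally_constant_comp (@iter_sigma_continuous _ _ n) ck.
- apply: (@locally_constant2 _ _ _ _ _ addn) => //.
  exact: locally_constant_comp (@iter_sigma_continuous _ _ n) cl.
move=> x; have [E Ef] := IH x; split=> [|f] /=.
  exact: tail_trans (hkl _) E.
rewrite (birkhoff_trans f (hkl (iter n sigma x)) E) -Ef.
by rewrite {1}/birkhoff big_ord_recr.
Qed.

End OrbitEquivalenceCocycle.

Lemma full_group_mulE {N : nat} {A : 'M[nat]_N} (s t : full_group A) x :
  full_group_fun (s * t)%g x = full_group_fun s (full_group_fun t x).
Proof. by []. Qed.

Section FullGroupConjugation.
Context {N M : nat} {A : 'M[nat]_N} {B : 'M[nat]_M}.
Variables (h : markov_shift A -> markov_shift B) (hinv : markov_shift B -> markov_shift A).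
Variables (k l : markov_shift A -> nat).
Hypothesis h_homeo : homeomorphism h hinv.
Hypothesis coe : orbit_cocycles h k l.

(** The orbits of x and of its image under [t] meet after [lt] and [kt] steps. [Psi_map_birkhoff]
    along the first segment, followed by its reverse along the second, links h x to the image of t
    x; the exponents [kl'] of the conjugate are those of this composite arrow. *)
Lemma full_group_cocycle_transport (t : full_group A) :
  exists kl kl' : markov_shift A -> nat * nat,
  [/\ locally_constant (fst \o kl), locally_constant (snd \o kl),
      locally_constant (fst \o kl'), locally_constant (snd \o kl') & forall x,
    [/\ iter (kl' x).1 sigma (h (full_group_fun t x)) = iter (kl' x).2 sigma (h x),
        iter (kl x).1 sigma (full_group_fun t x) = iter (kl x).2 sigma x
      & forall f, birkhoff (Psi_map h k l f) (kl x).2 x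
                  - birkhoff (Psi_map h k l f) (kl x).1 (full_group_fun t x) =
                  birkhoff f (kl' x).2 (h x)
                  - birkhoff f (kl' x).1 (h (full_group_fun t x))]].
Proof.
have [ch _ _ _] := h_homeo.
have [ct _ _ _] := full_group_inv_funP t.
have [[kt lt] /= [/continuous_natP ckt /continuous_natP clt klt]] := full_group_cocycles t.
have [F HF] := choice (Psi_map_birkhoff coe).
pose a x := F (lt x) x; pose b x := F (kt x) (full_group_fun t x).
have ca (p : nat * nat -> nat) : (forall n, locally_constant (p \o F n)) ->
    locally_constant (p \o a).
  by move=> cF; apply: (locally_constant_diag (F := fun n x => p (F n x))).
have cb (p : nat * nat -> nat) : (forall n, locally_constant (p \o F n)) ->
    locally_constant (p \o b).
  move=> cF.
  apply: (locally_constant_diag (F := fun n x => p (F n (full_group_fun t x)))) => // n.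
  exact: locally_constant_comp ct (cF n).
have cF1 n : locally_constant (fst \o F n) by have [] := HF n.
have cF2 n : locally_constant (snd \o F n) by have [] := HF n.
exists (fun x => (kt x, lt x)), (fun x => ((b x).2 + (a x).1, (a x).2 + (b x).1))%N.
split=> //.
- exact: (@locally_constant2 _ _ _ _ _ addn (snd \o b) (fst \o a) (cb _ cF2) (ca _ cF1)).
- exact: (@locally_constant2 _ _ _ _ _ addn (snd \o a) (fst \o b) (ca _ cF2) (cb _ cF1)).
move=> x.
have [_ _ /(_ x)[aE af]] := HF (lt x).
have [_ _ /(_ (full_group_fun t x))[bE bf]] := HF (kt x).
rewrite klt in bE; split=> [||f] //=; first exact: tail_trans (esym bE) aE.
rewrite (birkhoff_trans f (esym bE) aE) af bf klt.
by rewrite opprB.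
Qed.

Lemma full_group_conj_subproof (t : full_group A) :
  (h \o full_group_fun t \o hinv) \in @full_group_set _ B.
Proof.
have [ch chi hK hiK] := h_homeo.
have [ct cti tK tiK] := full_group_inv_funP t.
apply/mem_set; split.
  exists (h \o full_group_inv_fun t \o hinv); split.
  - move=> x; apply: continuous_comp; first exact: chi.
    by apply: continuous_comp; [exact: ct|exact: ch].
  - move=> x; apply: continuous_comp; first exact: chi.
    by apply: continuous_comp; [exact: cti|exact: ch].
  - by move=> x /=; rewrite hK tK.
  - by move=> x /=; rewrite hK tiK.
have [kl0 [kl [_ _ c1 c2 H]]] := full_group_cocycle_transport t.
exists (fst \o kl \o hinv, snd \o kl \o hinv); split => /=.
- by apply/continuous_natP; exact: locally_constant_comp chi c1.
- by apply/continuous_natP; exact: locally_constant_comp chi c2.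
- by move=> w; have [E _ _] := H (hinv w); rewrite E hiK.
Qed.

Definition full_group_conj (t : full_group A) : full_group B :=
  exist (fun t => t \in @full_group_set _ B) _ (full_group_conj_subproof t).

Lemma full_group_conjE t w :
  full_group_fun (full_group_conj t) w = h (full_group_fun t (hinv w)).
Proof. by []. Qed.

Lemma full_group_conj_mul : {morph full_group_conj : s t / (s * t)%g}.
Proof.
have [_ _ hK _] := h_homeo.
move=> s t; apply: full_group_inj => x.
by rewrite full_group_conjE [RHS]full_group_mulE !full_group_conjE hK.
Qed.

HB.instance Definition _ :=
  isMultiplicative.Build (full_group A) (full_group B) full_group_conj full_group_conj_mul.

End FullGroupConjugation.

Lemma rho_cocycleE {N : nat} {A : 'M[nat]_N} (A01 : zero_one_mx A)
  (Airr : irreducible_mx A) (Aperm : ~~ is_perm_mx A) f (t : full_group A)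
  (k l : markov_shift A -> nat) x :
  locally_constant k -> locally_constant l ->
  (forall x, iter (k x) sigma (full_group_fun t x) = iter (l x) sigma x) ->
  rho_cocycle f (x, t) = birkhoff f (l x) x - birkhoff f (k x) (full_group_fun t x).
Proof.
move=> ck cl kl; rewrite /rho_cocycle /full_group_kl /=.
case: cid => -[kt lt] /= [/continuous_natP ckt /continuous_natP clt klt].
apply: birkhoff_lag => //.
exact: (lag_unique A01 Airr Aperm _ ckt clt ck cl klt kl).
Qed.

Lemma rho_cocycle_conj {N M : nat} {A : 'M[nat]_N} {B : 'M[nat]_M}
  (A01 : zero_one_mx A) (Airr : irreducible_mx A) (Aperm : ~~ is_perm_mx A)
  (B01 : zero_one_mx B) (Birr : irreducible_mx B) (Bperm : ~~ is_perm_mx B)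
  h hinv k l (h_homeo : homeomorphism h hinv) (coe : @orbit_cocycles N M A B h k l)
  f x (t : full_group A) :
  rho_cocycle (Psi_map h k l f) (x, t) =
  rho_cocycle f (h x, full_group_conj h_homeo coe t).
Proof.
have [ch chi hK hiK] := h_homeo.
have [kl [kl' [c1 c2 c1' c2' H]]] := full_group_cocycle_transport h_homeo coe t.
rewrite (rho_cocycleE A01 Airr Aperm _ _ c1 c2); last by move=> y; have [] := H y.
rewrite (@rho_cocycleE _ _ B01 Birr Bperm _ _ (fst \o kl' \o hinv) (snd \o kl' \o hinv)).
- by have [_ _ /(_ f)] := H x; rewrite full_group_conjE /= !hK.
- exact: locally_constant_comp chi c1'.
- exact: locally_constant_comp chi c2'.
- by move=> w; have [E _ _] := H (hinv w); rewrite full_group_conjE /= E hiK.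
Qed.

Lemma nbhs_discrete (T : choiceType) (t : discrete_topology T)
  (Q : set (discrete_topology T)) : Q t -> nbhs t Q.
Proof. by move=> Qt; rewrite nbhs_principalE; apply/principal_filterP. Qed.

(** * Pull-back of cohomology along an equivariant pair of maps *)

Section CohomologyPullback.
Context {N M : nat} {A : 'M[nat]_N} {B : 'M[nat]_M}.
Variables (g : markov_shift B -> markov_shift A) (eta : full_group B -> full_group A).
Hypothesis cg : continuous g.
Hypothesis etaM : {morph eta : s t / (s * t)%g}.
Hypothesis etaE : forall t w,
  full_group_fun (eta t) (g w) = g (full_group_fun t w).

Definition pull (r : markov_shift A * full_group A -> int)
  (p : markov_shift B * full_group B) : int := r (g p.1, eta p.2).

Lemma Z1_set_pull r : Z1_set r -> Z1_set (pull r).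
Proof.
move=> [/continuous_int_nbhs cr rM]; split; last first.
  by move=> w s t; rewrite /pull /= etaM rM etaE.
apply/continuous_int_nbhs => -[w t] /=.
have [[P Q] /= [nP nQ] PQ] := cr (g w, eta t).
exists (g @^-1` P, eta @^-1` Q) => /=.
  split; first exact: cg.
  by apply: nbhs_discrete; exact: (nbhs_singleton nQ).
by move=> [w' t'] /= [Pw Qt]; exact: (PQ (g w', eta t')).
Qed.

(** The default 0 is never taken, by [Z1_pullE]. *)
Definition Z1_pull (r : Z1 A) : Z1 B := insubd (0 : Z1 B) (pull (val r)).

Lemma Z1_pullE (r : Z1 A) : val (Z1_pull r) = pull (val r).
Proof.
rewrite /Z1_pull val_insubd ifT//; apply/asboolP; apply: Z1_set_pull.
by apply/asboolP; exact: (valP r).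
Qed.

Lemma Z1_pullB (r s : Z1 A) : Z1_pull (r - s) = Z1_pull r - Z1_pull s.
Proof.
apply: val_inj; rewrite raddfB /= !Z1_pullE raddfB /=; exact/funext.
Qed.

Lemma B1_pull (r : Z1 A) : r \in @B1_pred _ A -> Z1_pull r \in @B1_pred _ B.
Proof.
move=> /asboolP[b [/continuous_intP cb rb]]; apply/asboolP; exists (b \o g); split.
  by apply/continuous_intP; exact: locally_constant_comp cg cb.
by move=> w t; rewrite Z1_pullE /pull /= rb etaE.
Qed.

Definition H1_pull (c : H1 A) : H1 B := \pi_(H1 B)%qT (Z1_pull (repr c)).

(** [H1_pull] is computed on a chosen representative. Another one differs from it by a coboundary,
    which [B1_pull] sends to a coboundary. *)
Lemma H1_pull_pi (r : Z1 A) :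
  H1_pull (\pi_(H1 A)%qT r) = \pi_(H1 B)%qT (Z1_pull r).
Proof.
apply/eqP; rewrite /H1_pull -(Quotient.idealrBE (@B1_pred _ B : zmodClosed (Z1 B))).
rewrite -Z1_pullB; apply: B1_pull.
by rewrite (Quotient.idealrBE (@B1_pred _ A : zmodClosed (Z1 A))) reprK.
Qed.

Lemma H1_pullB : {morph H1_pull : c d / c - d}.
Proof.
move=> c d; rewrite -[c]reprK -[d]reprK -raddfB /=.
by rewrite !H1_pull_pi Z1_pullB raddfB.
Qed.

Lemma H1_pull_class r : Z1_set r -> H1_pull (H1_class r) = H1_class (pull r).
Proof.
move=> Zr; rewrite /H1_class H1_pull_pi; congr (\pi_(H1 B)%qT _); apply: val_inj.
rewrite Z1_pullE !val_insubd ifT; last exact/asboolP.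
by rewrite ifT//; apply/asboolP; exact: Z1_set_pull.
Qed.

End CohomologyPullback.

Lemma homeomorphism_sym (T U : topologicalType) (h : T -> U) (g : U -> T) :
  homeomorphism h g -> homeomorphism g h.
Proof. by move=> [? ? ? ?]; split. Qed.

Section Consequences.
Context {N M : nat} {A : 'M[nat]_N} {B : 'M[nat]_M}.
Hypotheses (A01 : zero_one_mx A) (Airr : irreducible_mx A) (Aperm : ~~ is_perm_mx A).
Hypotheses (B01 : zero_one_mx B) (Birr : irreducible_mx B) (Bperm : ~~ is_perm_mx B).
Variables (h : markov_shift A -> markov_shift B) (hinv : markov_shift B -> markov_shift A).
Variables (k1 l1 : markov_shift A -> nat) (k2 l2 : markov_shift B -> nat).
Hypotheses (h_homeo : homeomorphism h hinv).
Hypotheses (coe_h : orbit_cocycles h k1 l1) (coe_hinv : orbit_cocycles hinv k2 l2).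

Let xi := full_group_conj h_homeo coe_h.
Let eta := full_group_conj (homeomorphism_sym h_homeo) coe_hinv.

Let hK : cancel h hinv. Proof. by have [] := h_homeo. Qed.
Let hiK : cancel hinv h. Proof. by have [] := h_homeo. Qed.

Let xiK : cancel xi eta.
Proof. by move=> t; apply: full_group_inj => x; rewrite !full_group_conjE !hK. Qed.

Let etaK : cancel eta xi.
Proof. by move=> t; apply: full_group_inj => x; rewrite !full_group_conjE !hiK. Qed.

Lemma full_group_conj_iso : exists xi : {multiplicative full_group A -> full_group B},
  bijective xi /\ forall f : markov_shift B -> int, continuous_int f ->
    xi @` cocycle_subgroup (Psi_map h k1 l1 f) = cocycle_subgroup f.
Proof.
exists xi; split; first by exists eta.
move=> f _; apply/seteqP; split=> [_ [t tf <-] w|s sf].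
  by rewrite -(hiK w) -rho_cocycle_conj.
exists (eta s); last exact: etaK.
by move=> x; rewrite (rho_cocycle_conj _ _ _ _ _ _ h_homeo coe_h)// -/xi etaK.
Qed.

Lemma cohomology_iso : exists Phi_h : {additive H1 A -> H1 B},
  bijective Phi_h /\ forall f : markov_shift B -> int, continuous_int f ->
    Phi_h (H1_class (rho_cocycle (Psi_map h k1 l1 f))) = H1_class (rho_cocycle f).
Proof.
have [ch chi _ _] := h_homeo.
have etaM : {morph eta : s t / (s * t)%g} by exact: full_group_conj_mul.
have xiM : {morph xi : s t / (s * t)%g} by exact: full_group_conj_mul.
have etaE t w : full_group_fun (eta t) (hinv w) = hinv (full_group_fun t w).
  by rewrite full_group_conjE hiK.
have xiE t x : full_group_fun (xi t) (h x) = h (full_group_fun t x).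
  by rewrite full_group_conjE hK.
have pK r : pull h xi (pull hinv eta r) = r.
  by apply/funext => -[x t]; rewrite /pull /= hK xiK.
have pK' r : pull hinv eta (pull h xi r) = r.
  by apply/funext => -[x t]; rewrite /pull /= hiK etaK.
pose add_mx := GRing.isZmodMorphism.Build (H1 A) (H1 B) _ (H1_pullB chi etaM etaE).
pose P : {additive H1 A -> H1 B} := HB.pack (@H1_pull _ _ A B hinv eta) add_mx.
exists P; split.
  exists (H1_pull h xi) => c /=.
    rewrite -[c]reprK (H1_pull_pi chi)// (H1_pull_pi ch)//.
    by congr (\pi_(H1 A)%qT _); apply: val_inj; rewrite !Z1_pullE.
  rewrite -[c]reprK (H1_pull_pi ch)// (H1_pull_pi chi)//.
  by congr (\pi_(H1 B)%qT _); apply: val_inj; rewrite !Z1_pullE.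
move=> f _ /=.
have rE : pull hinv eta (rho_cocycle (Psi_map h k1 l1 f)) = rho_cocycle f.
  apply/funext => -[w t]; rewrite /pull /=.
  by rewrite (rho_cocycle_conj _ _ _ _ _ _ h_homeo coe_h)// -/xi etaK hiK.
(* [H1_class] has the default value 0 off [Z1_set]. Pulling back in both directions shows that the
   two functions lie in [Z1_set] together or both lie outside, so the classes match in either
   case. *)
have [Zr|nZr] := pselect (Z1_set (rho_cocycle (Psi_map h k1 l1 f))).
  by rewrite H1_pull_class// rE.
have nZr' : ~ Z1_set (rho_cocycle f).
  by rewrite -rE => /(Z1_set_pull ch xiM xiE); rewrite pK.
have cls0 (K : nat) (C : 'M[nat]_K) r : ~ @Z1_set _ C r -> H1_class r = 0.
  by move=> nr; rewrite /H1_class /insubd insubF ?raddf0//; apply/asboolPn.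
by rewrite (cls0 _ _ _ nZr) (cls0 _ _ _ nZr'); exact: (raddf0 P).
Qed.

End Consequences.

(** * The representation on functions on the shift *)

Section CuntzKriegerWords.
Context {R : realType} {N : nat} {A : 'M[nat]_N} {U : cstarAlgType R} {S : 'I_N -> U}.
Hypothesis A01 : zero_one_mx A.
Hypothesis CK : CK_family A S.

(** The range projections sum to 1, so they are orthogonal; inserting them between [cstar (S i)] and
    [S j] changes nothing. *)
Lemma CK_orthogonal i j : i != j -> cstar (S i) * S j = 0.
Proof.
have [SSS S1 _] := CK => ij.
have pij : (S i * cstar (S i)) * (S j * cstar (S j)) = 0.
  apply: (@projections_orthogonal _ _ _ (fun i => S i * cstar (S i))) => // k.
    by rewrite cstarM cstarK.
  by rewrite mulrA SSS.
have SSS' k : cstar (S k) * S k * cstar (S k) = cstar (S k).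
  by rewrite -[RHS](congr1 cstar (SSS k)) !cstarM cstarK mulrA.
have -> : cstar (S i) * S j =
    cstar (S i) * ((S i * cstar (S i)) * (S j * cstar (S j))) * S j.
  by rewrite !mulrA SSS' -!mulrA [S j * (_ * _)]mulrA SSS.
by rewrite pij mulr0 mul0r.
Qed.

Lemma CK_mul i j : cstar (S i) * S i * S j = (A i j)%:R *: S j.
Proof.
have [SSS _ ->] := CK; rewrite mulr_suml (bigD1 j)//= big1 ?addr0 => [|k kj].
  by rewrite mulrnAl SSS scaler_nat.
by rewrite mulrnAl -mulrA CK_orthogonal// mulr0 mul0rn.
Qed.

Lemma S_word_nil : S_word S [::] = 1.
Proof. by rewrite /S_word big_nil. Qed.

Lemma S_word_cons i mu : S_word S (i :: mu) = S i * S_word S mu.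
Proof. by rewrite /S_word big_cons. Qed.

Lemma S_word_rcons mu i : S_word S (rcons mu i) = S_word S mu * S i.
Proof. by rewrite /S_word -cats1 big_cat big_seq1. Qed.

Lemma S_word_inadmissible mu : ~~ admissible A mu -> S_word S mu = 0.
Proof.
have [SSS _ _] := CK.
case: mu => // i mu; elim: mu i => // j mu IH i.
rewrite /admissible /= negb_and => /orP[Aij|/IH jmu]; last first.
  by rewrite S_word_cons jmu mulr0.
have -> : S_word S [:: i, j & mu] = S i * (cstar (S i) * S i * S j) * S_word S mu.
  by rewrite !S_word_cons !mulrA SSS.
rewrite CK_mul.
by case: (A01 i j) Aij => ->// _; rewrite scale0r mulr0 mul0r.
Qed.

(** 1 is the sum of S_mu S_mu^* over the words mu of length n. *)
Lemma column_ext (V : U) n :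
  (forall mu, size mu = n -> V * S_word S mu = 0) -> V = 0.
Proof.
have [_ S1 _] := CK; elim: n => [|n IH] H.
  by rewrite -[V]mulr1 -S_word_nil H.
apply: IH => mu mun; rewrite -[LHS]mulr1 -S1 mulr_sumr big1// => i _.
by rewrite mulrA -(mulrA V) -S_word_rcons H ?mul0r// size_rcons mun.
Qed.

End CuntzKriegerWords.

(** * Words acting on functions on the shift *)

Section WordOperators.
Context {R : realType} {N : nat} {A : 'M[nat]_N}.
Hypothesis A01 : zero_one_mx A.
Local Notation X := (markov_shift A).
Local Notation op := ((X -> R[i]) -> X -> R[i]).
Implicit Types (mu : seq 'I_N) (x y z : X) (g : X -> R[i]).

Lemma in_cylinder_cons i mu x :
  in_cylinder (i :: mu) x = (val x 0%N == i) && in_cylinder mu (sigma x).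
Proof.
rewrite /in_cylinder /= /mkseq /= eqseq_cons; congr (_ && (_ == _)).
by rewrite (iotaDl 1 0) -map_comp.
Qed.

Lemma in_cylinderP mu x : reflect (exists y, in_cylinder mu y /\ agree (size mu) x y)
  (in_cylinder mu x).
Proof.
apply: (iffP idP) => [xmu|[y [/eqP ymu /agreeP xy]]]; first by exists x.
by rewrite /in_cylinder xy ymu.
Qed.

Lemma in_cylinder_agree mu x y : in_cylinder mu x -> in_cylinder mu y ->
  agree (size mu) x y.
Proof. by move=> /eqP xmu /eqP ymu; apply/agreeP; rewrite xmu. Qed.

Lemma in_cylinder_inj mu x y : in_cylinder mu x -> in_cylinder mu y ->
  iter (size mu) sigma x = iter (size mu) sigma y -> x = y.
Proof.
move=> xmu ymu xy; apply: markov_eq => i.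
have [im|mi] := ltnP i (size mu); first exact: (in_cylinder_agree xmu ymu).
by rewrite -(subnKC mi) -!iter_sigmaE xy.
Qed.

Definition op_word mu : op := fun g x =>
  if in_cylinder mu x then g (iter (size mu) sigma x) else 0.

(* [(op_adj mu g) x = g (mu x)] when the concatenation [mu x] is admissible. *)
Definition op_adj mu : op := fun g x =>
  if pselect (exists z, in_cylinder mu z /\ iter (size mu) sigma z = x) is left e
  then g (projT1 (cid e)) else 0.

Lemma op_adj_in mu g z : in_cylinder mu z ->
  op_adj mu g (iter (size mu) sigma z) = g z.
Proof.
move=> zmu; rewrite /op_adj; case: pselect => [e|[]]; last by exists z.
case: cid => y /= [ymu yz]; congr g; exact: in_cylinder_inj yz.
Qed.

Lemma op_adj_out mu g x :
  (forall z, in_cylinder mu z -> iter (size mu) sigma z <> x) -> op_adj mu g x = 0.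
Proof. by move=> H; rewrite /op_adj; case: pselect => // e; have [z [/H]] := e. Qed.

Variant op_adj_spec mu g x : R[i] -> Prop :=
| OpAdjIn z of in_cylinder mu z & iter (size mu) sigma z = x : op_adj_spec mu g x (g z)
| OpAdjOut of (forall z, in_cylinder mu z -> iter (size mu) sigma z <> x) :
    op_adj_spec mu g x 0.

Lemma op_adjP mu g x : op_adj_spec mu g x (op_adj mu g x).
Proof.
have [[z [zmu zx]]|nz] := pselect (exists z, in_cylinder mu z /\ iter (size mu) sigma z = x).
  by rewrite -[in op_adj _ _ _]zx op_adj_in//; apply: OpAdjIn.
rewrite op_adj_out => [|z zmu zx]; last by apply: nz; exists z.
by apply: OpAdjOut => z zmu zx; apply: nz; exists z.
Qed.

Lemma op_word_cons i mu : op_word (i :: mu) = op_word [:: i] \o op_word mu.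
Proof.
apply/funext => g; apply/funext => x; rewrite /op_word /= !in_cylinder_cons /=.
by rewrite /in_cylinder /= andbT -iterSr; case: eqP.
Qed.

Lemma op_adj_cons i mu : op_adj (i :: mu) = op_adj mu \o op_adj [:: i].
Proof.
apply/funext => g; apply/funext => x /=.
case: (op_adjP mu (op_adj [:: i] g) x) => [y ymu yx|nx].
  case: (op_adjP [:: i] g y) => [z zi zy|ny].
    rewrite -yx -[y]zy -iterD addn1 -[_.+1]/(size (i :: mu)) op_adj_in//.
    rewrite in_cylinder_cons -[sigma z]/(iter 1 sigma z) [iter 1 _ _]zy ymu andbT.
    by move: zi; rewrite in_cylinder_cons => /andP[].
  apply: op_adj_out => z; rewrite in_cylinder_cons => /andP[zi zmu].
  rewrite /= -iterS iterSr -yx => zy.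
  by apply: (ny z); [rewrite in_cylinder_cons zi|exact: in_cylinder_inj zy].
apply: op_adj_out => z; rewrite in_cylinder_cons => /andP[zi zmu].
by rewrite /= -iterS iterSr; exact: nx.
Qed.

End WordOperators.

(** * The *-algebra of the generators acts faithfully on functions *)

Section Representation.
Context {R : realType} {N : nat} {A : 'M[nat]_N} {U : cstarAlgType R}.
Variable S : 'I_N -> U.
Local Notation X := (markov_shift A).
Local Notation op := ((X -> R[i]) -> X -> R[i]).

(* [rep V K K']: the element [V] of the *-algebra generated by the [S i] acts
   on functions on the shift as [K], and [cstar V] acts as [K']. *)
Inductive rep : U -> op -> op -> Prop :=
| rep_gen i : rep (S i) (op_word [:: i]) (op_adj [:: i])
| rep_one : rep 1 (fun g => g) (fun g => g)
| rep_star V K K' : rep V K K' -> rep (cstar V) K' K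
| rep_add V K K' W L L' : rep V K K' -> rep W L L' ->
    rep (V + W) (fun g x => K g x + L g x) (fun g x => K' g x + L' g x)
| rep_scale c V K K' : rep V K K' ->
    rep (c *: V) (fun g x => c * K g x) (fun g x => (c^*)%C * K' g x)
| rep_mul V K K' W L L' : rep V K K' -> rep W L L' ->
    rep (V * W) (K \o L) (L' \o K').

Lemma rep_ext V K K' L L' : rep V K K' ->
  (forall g x, K g x = L g x) -> (forall g x, K' g x = L' g x) -> rep V L L'.
Proof.
move=> r KL KL'; have <- : K = L by apply/funext => g; exact/funext.
by have <- : K' = L' by apply/funext => g; exact/funext.
Qed.

Lemma rep_sum (I : Type) (s : seq I) (V : I -> U) (K K' : I -> op) :
  (forall i, rep (V i) (K i) (K' i)) ->
  rep (\sum_(i <- s) V i) (fun g x => \sum_(i <- s) K i g x)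
    (fun g x => \sum_(i <- s) K' i g x).
Proof.
move=> r; elim: s => [|i s IH].
  rewrite big_nil -(scale0r 1); apply: rep_ext (rep_scale 0 rep_one) _ _ => g x.
    by rewrite big_nil mul0r.
  by rewrite big_nil rmorph0 mul0r.
rewrite big_cons; apply: rep_ext (rep_add (r i) IH) _ _ => g x; by rewrite big_cons.
Qed.

Lemma rep_word mu : rep (S_word S mu) (op_word mu) (op_adj mu).
Proof.
elim: mu => [|i mu IH].
  rewrite S_word_nil; apply: rep_ext rep_one _ _ => g x.
    by rewrite /op_word /in_cylinder eqxx.
  by rewrite -[x in RHS]/(iter (size ([::] : seq 'I_N)) sigma x) op_adj_in.
by rewrite S_word_cons op_word_cons op_adj_cons; apply: rep_mul => //; exact: rep_gen.
Qed.

Lemma rep_proj mu : rep (S_proj S mu)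
  (fun g x => if in_cylinder mu x then g x else 0)
  (fun g x => if in_cylinder mu x then g x else 0).
Proof.
have r := rep_word mu.
by apply: rep_ext (rep_mul r (rep_star r)) _ _ => g x;
  rewrite /= /op_word; case: ifP => // xmu; rewrite op_adj_in.
Qed.

Definition op_linear (K : op) := forall c g1 g2 x,
  K (fun y => c * g1 y + g2 y) x = c * K g1 x + K g2 x.

Lemma op_word_linear mu : op_linear (op_word mu).
Proof. by move=> c g1 g2 x; rewrite /op_word; case: ifP; rewrite ?mulr0 ?addr0. Qed.

Lemma op_adj_linear mu : op_linear (op_adj mu).
Proof.
move=> c g1 g2 x; have [[z [zmu <-]]|nz] := pselect (exists z : X,
    in_cylinder mu z /\ iter (size mu) sigma z = x).
  by rewrite !op_adj_in.
have nz' z : in_cylinder mu z -> iter (size mu) sigma z <> x.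
  by move=> zmu zx; apply: nz; exists z.
by rewrite !op_adj_out// mulr0 addr0.
Qed.

Lemma rep_linear V K K' : rep V K K' -> op_linear K /\ op_linear K'.
Proof.
elim=> {V K K'}.
- by move=> i; split; [exact: op_word_linear|exact: op_adj_linear].
- by [].
- by move=> V K K' _ [].
- by move=> V K K' W L L' _ [lK lK'] _ [lL lL']; split=> c g1 g2 x;
    rewrite ?lK ?lK' ?lL ?lL' mulrDr addrACA.
- by move=> a V K K' _ [lK lK']; split=> c g1 g2 x;
    rewrite ?lK ?lK' mulrDr mulrCA.
- move=> V K K' W L L' _ [lK lK'] _ [lL lL']; split=> c g1 g2 x /=.
    by rewrite -lK; congr (K _ x); apply/funext => y; rewrite lL.
  by rewrite -lL'; congr (L' _ x); apply/funext => y; rewrite lK'.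
Qed.

Lemma op_linear0 K x : op_linear K -> K (fun=> 0) x = 0.
Proof.
move=> lK; have := lK (-1) (fun=> 0) (fun=> 0) x.
rewrite [RHS](_ : _ = 0); last by rewrite mulN1r addNr.
apply: etrans; congr (K _ x); apply/funext => y.
by rewrite mulr0 addr0.
Qed.

(** The last letter [a] is never consumed. When an adjoint cancels the first letter of a word, there
    is thus always a next letter to absorb the remaining source projection. *)
Definition word_sum a (s : seq (R[i] * seq 'I_N)) : U :=
  \sum_(p <- s) p.1 *: S_word S (rcons p.2 a).

Definition op_sum a (s : seq (R[i] * seq 'I_N)) : op :=
  fun g x => \sum_(p <- s) p.1 * op_word (rcons p.2 a) g x.

(* On long words, [V] creates words and annihilates none. *)
Definition creates (V : U) (K : op) (d : nat) := forall m mu a, (m + d <= size mu)%N ->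
  exists s, [/\ all (fun p => m <= size p.2)%N s,
    V * S_word S (rcons mu a) = word_sum a s
  & forall g x, K (op_word (rcons mu a) g) x = op_sum a s g x].

Lemma creates_le V K d d' : (d <= d')%N -> creates V K d -> creates V K d'.
Proof.
by move=> dd' H m mu a md; apply: H; apply: leq_trans md; rewrite leq_add2l.
Qed.

Lemma creates_sum V K d m a s : op_linear K -> creates V K d ->
  all (fun p => m + d <= size p.2)%N s ->
  exists s', [/\ all (fun p => m <= size p.2)%N s',
    V * word_sum a s = word_sum a s'
  & forall g x, K (op_sum a s g) x = op_sum a s' g x].
Proof.
move=> lK H; elim: s => [_|[c mu] s IH /= /andP[mud /IH[s1 [s1m V1 K1]]]].
  exists [::]; split=> //; first by rewrite /word_sum !big_nil mulr0.
  move=> g x; rewrite /op_sum big_nil -[RHS](op_linear0 x lK).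
  by congr (K _ x); apply/funext => y; rewrite big_nil.
have [s2 [s2m V2 K2]] := H m mu a mud.
exists ([seq (c * p.1, p.2) | p <- s2] ++ s1); split.
- by rewrite all_cat all_map s1m andbT; apply: sub_all s2m => p.
- rewrite /word_sum big_cons big_cat big_map /= -/(word_sum a s) -/(word_sum a s1).
  rewrite mulrDr V1 -scalerAr V2 scaler_sumr.
  by congr (_ + _); apply: eq_bigr => p _; rewrite scalerA.
- move=> g x; rewrite /op_sum big_cat big_map /= -/(op_sum a s1 g x) -K1.
  under eq_bigr do rewrite -mulrA.
  rewrite -mulr_sumr -/(op_sum a s2 g x) -K2 -lK; congr (K _ x).
  by apply/funext => y; rewrite /op_sum big_cons.
Qed.

Hypothesis A01 : zero_one_mx A.
Hypothesis CK : CK_family A S.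

(** One letter is consumed: a different first letter gives 0 by orthogonality, and the same one
    leaves the factor A(j, b), where b is the next letter. *)
Lemma creates_adj i : creates (cstar (S i)) (op_adj [:: i]) 1.
Proof.
move=> m [|j mu] a; rewrite addn1// ltnS => mmu.
have [->|ij] := eqVneq i j; last first.
  exists [::]; split=> //.
    by rewrite /word_sum big_nil S_word_cons mulrA (CK_orthogonal CK)// mul0r.
  move=> g x; rewrite /op_sum big_nil; case: op_adjP => // z zi _.
  rewrite /op_word /= in_cylinder_cons; move: zi; rewrite in_cylinder_cons.
  by move=> /andP[/eqP -> _]; rewrite (negbTE ij).
have [b [nu bnu]] : exists b nu, rcons mu a = b :: nu.
  by case: mu {mmu} => [|b nu]; [exists a, [::]|exists b, (rcons nu a)].
exists [:: ((A j b)%:R, mu)]; split=> /=; first by rewrite mmu.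
  rewrite /word_sum big_seq1 S_word_cons mulrA /= bnu S_word_cons mulrA (CK_mul CK).
  by rewrite -scalerAl.
move=> g x; rewrite /op_sum big_seq1 /=; case: op_adjP => [z zj <-|nz].
  rewrite {1}/op_word in_cylinder_cons.
  move: zj; rewrite in_cylinder_cons => /andP[z0j _]; rewrite z0j /=.
  rewrite /op_word; case: ifP => [|_]; last by rewrite mulr0.
  rewrite bnu in_cylinder_cons => /andP[/eqP <- _].
  by rewrite -(eqP z0j) (markovP z 0) mul1r -iterS iterSr.
rewrite /op_word; case: ifP => [|_]; last by rewrite mulr0.
rewrite bnu in_cylinder_cons => /andP[/eqP xb _].
case: (A01 j b) => Ajb; first by rewrite Ajb mul0r.
rewrite -xb in Ajb; have [z zj zx] := cons_ex Ajb.
by case: (nz z) => //; rewrite in_cylinder_cons zj eqxx.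
Qed.

Lemma creates_gen i : creates (S i) (op_word [:: i]) 0.
Proof.
move=> m mu a; rewrite addn0 => mmu; exists [:: (1, i :: mu)]; split=> /=.
- by rewrite leqW.
- by rewrite /word_sum big_seq1 scale1r S_word_cons.
- by move=> g x; rewrite /op_sum big_seq1 mul1r [in RHS]op_word_cons.
Qed.

Lemma creates_one : creates 1 (fun g => g) 0.
Proof.
move=> m mu a; rewrite addn0 => mmu; exists [:: (1, mu)]; split=> /=.
- by rewrite mmu.
- by rewrite /word_sum big_seq1 scale1r mul1r.
- by move=> g x; rewrite /op_sum big_seq1 mul1r.
Qed.

Lemma creates_add V K d W L e : creates V K d -> creates W L e ->
  creates (V + W) (fun g x => K g x + L g x) (maxn d e).
Proof.
move=> /(creates_le (leq_maxl d e)) cV /(creates_le (leq_maxr d e)) cW m mu a mmu.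
have [s [sm V1 K1]] := cV m mu a mmu; have [t [tm W1 L1]] := cW m mu a mmu.
exists (s ++ t); split; first by rewrite all_cat sm.
  by rewrite /word_sum big_cat mulrDl V1 W1.
by move=> g x; rewrite /op_sum big_cat K1 L1.
Qed.

Lemma creates_scale c V K d : creates V K d ->
  creates (c *: V) (fun g x => c * K g x) d.
Proof.
move=> cV m mu a mmu; have [s [sm V1 K1]] := cV m mu a mmu.
exists [seq (c * p.1, p.2) | p <- s]; split.
- by rewrite all_map; apply: sub_all sm.
- rewrite /word_sum big_map -scalerAl V1 scaler_sumr.
  by apply: eq_bigr => p _; rewrite scalerA.
- move=> g x; rewrite /op_sum big_map K1 mulr_sumr.
  by apply: eq_bigr => p _; rewrite mulrA.
Qed.

Lemma creates_mul V K d W L e : op_linear K -> creates V K d -> creates W L e ->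
  creates (V * W) (K \o L) (d + e).
Proof.
move=> lK cV cW m mu a; rewrite addnA => mmu.
have [s [sm W1 L1]] := cW _ mu a mmu.
have [t [tm V1 K1]] := creates_sum a lK cV sm.
exists t; split=> //; first by rewrite -mulrA W1.
by move=> g x; rewrite /= -K1; congr (K _ x); apply/funext => y; rewrite L1.
Qed.

Lemma rep_creates V K K' : rep V K K' ->
  (exists d, creates V K d) /\ (exists d, creates (cstar V) K' d).
Proof.
elim=> {V K K'}.
- by move=> i; split; [exists 0%N; exact: creates_gen|exists 1%N; exact: creates_adj].
- by rewrite cstar1; split; exists 0%N; exact: creates_one.
- by move=> V K K' _ [cV cV']; rewrite cstarK.
- move=> V K K' W L L' _ [[d dV] [d' dV']] _ [[e eW] [e' eW']]; rewrite cstarD.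
  by split; eexists; apply: creates_add; eassumption.
- move=> c V K K' _ [[d dV] [d' dV']]; rewrite cstarZ.
  by split; eexists; apply: creates_scale; eassumption.
- move=> V K K' W L L' rV [[d dV] [d' dV']] rW [[e eW] [e' eW']]; rewrite cstarM.
  have [lK _] := rep_linear rV; have [_ lL'] := rep_linear rW.
  by split; eexists; apply: creates_mul; eassumption.
Qed.

Hypothesis Airr : irreducible_mx A.
Hypothesis Aperm : ~~ is_perm_mx A.

Lemma op_sum_inj a s : (forall g x, op_sum a s g x = 0) -> word_sum a s = 0.
Proof.
move=> H; rewrite /word_sum.
(* Equal words are collected, since the list may repeat them; each total coefficient is then shown
   to vanish when its word is admissible. *)
have -> : \sum_(p <- s) p.1 *: S_word S (rcons p.2 a) =
    \sum_(nu <- undup [seq p.2 | p <- s])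
      (\sum_(p <- s | p.2 == nu) p.1) *: S_word S (rcons nu a).
  under [RHS]eq_bigr => nu _ do rewrite scaler_suml.
  rewrite [RHS](exchange_big_dep xpredT)//= [LHS]big_seq [RHS]big_seq.
  apply: eq_bigr => p ps.
  rewrite (big_rem p.2) /= ?mem_undup ?map_f// eqxx big_seq_cond big1 ?addr0//.
  by move=> nu /andP[]; rewrite mem_rem_uniq ?undup_uniq// inE => /andP[/negP np _] /eqP pnu;
    case: np; rewrite pnu.
rewrite big1_seq// => nu _.
have [nua|nua] := boolP (admissible A (rcons nu a)); last first.
  by rewrite (S_word_inadmissible A01 CK)// scaler0.
suff -> : \sum_(p <- s | p.2 == nu) p.1 = 0 by rewrite scale0r.
pose n := \max_(p <- s) size p.2.
have [x xnu] : exists x : X, in_cylinder (rcons nu a) x.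
  elim: nu nua => [|b nu IH] nua.
    have [x xa] := point_at A01 Airr a; exists x.
    by rewrite in_cylinder_cons xa eqxx.
  have [|x xnu] := IH; first by move: nua; rewrite /admissible /=; exact: path_sorted.
  have [|z zb zx] := @cons_ex _ A b x.
    move: nua xnu; case: nu {IH} => [|c nu] /=.
      by rewrite /admissible /= andbT in_cylinder_cons => /eqP + /andP[/eqP ->].
    by rewrite /admissible /= in_cylinder_cons => /andP[/eqP + _] /andP[/eqP ->].
  by exists z; rewrite rcons_cons in_cylinder_cons zb eqxx zx.
(* The tail after [nu] is made aperiodic up to a bound that exceeds every difference of two word
   lengths. Its first letter, which is [a], is kept, so that [nu] can still be put in front. *)
have [y0 xy0 ny0] := aperiodic_ex A01 Airr Aperm (n + size nu) (iter (size nu) sigma x) 1.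
have [|z xz zy] := @prepend_ex _ A (size nu) x y0.
  by rewrite -xy0// iter_sigmaE addn0.
have znu : in_cylinder (rcons nu a) z.
  apply/in_cylinderP; exists x; split=> //; apply: agree_sym.
  rewrite size_rcons => i; rewrite ltnS leq_eqVlt => /orP[/eqP ->|/xz//].
  have := xy0 0%N (ltn0Sn _); rewrite iter_sigmaE addn0 => ->.
  by rewrite -zy iter_sigmaE addn0.
pose y := iter (size (rcons nu a)) sigma z.
(* Evaluated at [z], this indicator leaves only the words that are prefixes of [z] and after which
   the tail is [y]. A word other than [nu] among them would have another length and so give [y0] a
   period. *)
pose g w : R[i] := (w == y)%:R.
rewrite -[RHS](H g z) /op_sum big_mkcond big_seq [RHS]big_seq.
apply: eq_bigr => p ps; rewrite /op_word.
have [->|pnu] := eqVneq p.2 nu; first by rewrite znu /g eqxx mulr1.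
case: ifP => [zp|_]; last by rewrite mulr0.
rewrite /g; case: eqP => [zpy|_]; last by rewrite mulr0.
have letter mu : in_cylinder (rcons mu a) z -> mkseq (val z) (size mu) = mu /\
    val z (size mu) = a.
  rewrite /in_cylinder size_rcons mkseqS eqseq_rcons.
  by move=> /andP[/eqP -> /eqP ->].
have [zp1 zpa] := letter _ zp; have [znu1 znua] := letter _ znu.
have tails : iter (size p.2) sigma z = iter (size nu) sigma z.
  apply: markov_eq => -[|i]; first by rewrite !iter_sigmaE !addn0 zpa znua.
  have := congr1 (fun w : X => val w i) zpy.
  by rewrite /y !iter_sigmaE !size_rcons !addSnnS.
have pn : (size p.2 <= n)%N by rewrite /n (big_rem p)//= leq_max leqnn.
case: (ltngtP (size p.2) (size nu)) => [pq|pq|pq]; last first.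
- by rewrite -zp1 pq znu1 eqxx in pnu.
- case: (ny0 (size p.2 - size nu)%N).
    by rewrite subn_gt0 pq (leq_trans (leq_subr _ _))// (leq_trans pn)// leq_addr.
  by rewrite -zy -iterD subnK 1?ltnW.
- case: (ny0 (size nu - size p.2)%N).
    by rewrite subn_gt0 pq (leq_trans (leq_subr _ _))// leq_addl.
  by rewrite -zy -{1}tails -iterD subnK 1?ltnW.
Qed.

Lemma rep_faithful V K K' : rep V K K' -> (forall g x, K g x = 0) -> V = 0.
Proof.
move=> /rep_creates[[d cV] _] K0.
(* One letter beyond the d that [cV] asks for serves as the fixed last letter. *)
apply: (column_ext CK (n := d.+1)) => mu; case: (lastP mu) => // nu a.
rewrite size_rcons => -[nud]; have [|s [_ -> Ks]] := cV 0%N nu a; first by rewrite nud.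
by apply: op_sum_inj => g x; rewrite -Ks K0.
Qed.

Lemma rep_inj V W K K' L L' : rep V K K' -> rep W L L' ->
  (forall g x, K g x = L g x) -> V = W.
Proof.
move=> rV rW KL; apply/eqP; rewrite -subr_eq0; apply/eqP.
rewrite -scaleN1r; apply: (rep_faithful (rep_add rV (rep_scale (-1) rW))) => g x.
by rewrite KL mulN1r subrr.
Qed.

End Representation.

(** * Cutting a tail-preserving partial map into prefix replacements *)

Section Bisection.
Context {N : nat} {A : 'M[nat]_N}.
Local Notation X := (markov_shift A).

Lemma locally_constant_bounded (l : X -> nat) : locally_constant l ->
  exists b, forall x, (l x <= b)%N.
Proof.
move=> /locally_constant_uniform[m H].
have /choice[b Hb] : forall mu : m.-tuple 'I_N, exists b, forall x : X,
    in_cylinder mu x -> l x = b.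
  move=> mu; have [[x xmu]|nx] := pselect (exists x : X, in_cylinder mu x).
    exists (l x) => y ymu; apply: H.
    by have := in_cylinder_agree xmu ymu; rewrite size_tuple.
  by exists 0%N => x xmu; case: nx; exists x.
exists (\max_mu b mu) => x.
pose mu : m.-tuple 'I_N := [tuple of mkseq (val x) m].
by rewrite (Hb mu) ?leq_bigmax//= mkseq_in_cylinder.
Qed.

Variables (D : pred X) (alpha : X -> X) (k l : X -> nat).
Hypothesis cD : locally_constant D.
Hypothesis calpha : continuous alpha.
Hypothesis ck : locally_constant k.
Hypothesis cl : locally_constant l.
Hypothesis kl : forall w, D w -> iter (k w) sigma (alpha w) = iter (l w) sigma w.

(* On the cylinder of [p.1], [alpha] replaces the prefix [p.1] by [p.2]. *)
Definition bisection (s : seq (seq 'I_N * seq 'I_N)) : Prop :=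
  [/\ uniq s,
      forall p, p \in s -> forall w, in_cylinder p.1 w ->
        [/\ D w, in_cylinder p.2 (alpha w),
            iter (size p.1) sigma w = iter (size p.2) sigma (alpha w)
          & (size p.1 + k w = size p.2 + l w)%N],
      forall w, D w -> exists2 p, p \in s & in_cylinder p.1 w
    & forall p q (w : X), p \in s -> q \in s ->
        in_cylinder p.1 w -> in_cylinder q.1 w -> p = q].

(** Take cylinders of a common length m >= l on which [D], [k], [l] and the first k letters of
    [alpha] are constant. There [alpha w] consists of these k letters followed by w from position l
    on, so the prefix of length m is replaced by one of length k + (m - l); whence the equation
    between lengths and exponents. *)
Lemma bisection_ex : exists s, bisection s.
Proof.
have [m1 H1] := locally_constant_uniform cD.
have [m2 H2] := locally_constant_uniform ck.
have [m3 H3] := locally_constant_uniform cl.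
have [m4 H4] : exists m, forall x y, agree m x y ->
    mkseq (val (alpha y)) (k y) = mkseq (val (alpha x)) (k x).
  apply: locally_constant_uniform.
  apply: (locally_constant_diag (F := fun n x => mkseq (val (alpha x)) n)) => // n.
  by move/continuous_agreeP : calpha; apply.
have [b Hb] := locally_constant_bounded cl.
pose m := maxn (maxn m1 m2) (maxn (maxn m3 m4) b).
have m1m : (m1 <= m)%N by rewrite !leq_max leqnn.
have m2m : (m2 <= m)%N by rewrite !leq_max leqnn !orbT.
have m3m : (m3 <= m)%N by rewrite !leq_max leqnn !orbT.
have m4m : (m4 <= m)%N by rewrite !leq_max leqnn !orbT.
have lm w : (l w <= m)%N by rewrite (leq_trans (Hb w))// !leq_max leqnn !orbT.
have cyl (mu : m.-tuple 'I_N) (x y : X) : in_cylinder mu x -> in_cylinder mu y -> agree m x y.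
  by move=> xmu ymu; have := in_cylinder_agree xmu ymu; rewrite size_tuple.
have /choice[e He] : forall mu : m.-tuple 'I_N, exists eta, forall w,
    in_cylinder mu w -> D w ->
    [/\ in_cylinder eta (alpha w), iter m sigma w = iter (size eta) sigma (alpha w)
      & (m + k w = size eta + l w)%N].
  move=> mu; have [[x [xmu Dx]]|nx] := pselect (exists x, in_cylinder mu x /\ D x); last first.
    by exists [::] => w wmu Dw; case: nx; exists w.
  exists (mkseq (val (alpha x)) (k x + (m - l x))) => w wmu Dw.
  have xw : agree m x w := cyl mu _ _ xmu wmu.
  have kw : k w = k x by apply: H2; exact: agree_le xw.
  have lw : l w = l x by apply: H3; exact: agree_le xw.
  have aw := H4 _ _ (agree_le m4m xw); have kxl := kl Dx; have kwl := kl Dw.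
  rewrite size_mkseq; split; last by rewrite kw lw; have := lm x; lia.
    rewrite /in_cylinder size_mkseq; apply/eqP/agreeP => i im.
    have [ik|ki] := ltnP i (k x).
      by move: aw; rewrite kw => /agreeP; apply.
    rewrite -(subnKC ki) -!iter_sigmaE kxl -{1}kw kwl !iter_sigmaE lw.
    by apply/esym/xw; lia.
  rewrite [X in iter X sigma w = _](_ : _ = (m - l w + l w)%N); last by rewrite subnK.
  by rewrite iterD -kwl -iterD kw lw addnC.
pose meets_D (mu : m.-tuple 'I_N) := `[< exists w, in_cylinder mu w /\ D w >].
exists [seq (tval mu, e mu) | mu <- [seq mu <- enum {: m.-tuple 'I_N} | meets_D mu]]; split.
- by rewrite map_inj_uniq => [|mu nu [/val_inj]//]; exact/filter_uniq/enum_uniq.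
- move=> _ /mapP[mu + ->] w /= wmu; rewrite mem_filter => /andP[/asboolP[x [xmu Dx]] _].
  have Dw : D w by rewrite (H1 x)//; exact: agree_le m1m (cyl mu _ _ xmu wmu).
  by have [? ? ?] := He mu w wmu Dw; rewrite size_tuple; split.
- move=> w Dw; pose mu : m.-tuple 'I_N := [tuple of mkseq (val w) m].
  exists (tval mu, e mu) => /=; last exact: mkseq_in_cylinder.
  apply/mapP; exists mu => //; rewrite mem_filter mem_enum andbT; apply/asboolP.
  by exists w; split=> //; exact: mkseq_in_cylinder.
- move=> _ _ w /mapP[mu _ ->] /mapP[nu _ ->] /= /eqP wmu /eqP wnu.
  suff -> : mu = nu by [].
  by apply: val_inj; rewrite /= -wmu -wnu !size_tuple.
Qed.

End Bisection.

Section BisectionOperators.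
Context {R : realType} {N : nat} {A : 'M[nat]_N}.
Local Notation X := (markov_shift A).
Variables (D D' : pred X) (alpha beta : X -> X) (k l : X -> nat).
Variable s : seq (seq 'I_N * seq 'I_N).
Hypothesis bis : bisection D alpha k l s.
Hypothesis alphaD : forall w, D w -> D' (alpha w) /\ beta (alpha w) = w.
Hypothesis betaD : forall w, D' w -> D (beta w) /\ alpha (beta w) = w.

(** Disjointness leaves a single summand at [w]. The weights are general for two uses: they are 1 in
    [rep_bisection] and phases of Birkhoff sums in [transport_gauge]. *)
Lemma op_bisection (c c' : nat -> X -> R[i]) (F : X -> R[i]) (g : X -> R[i]) w :
  (forall p, p \in s -> forall w, in_cylinder p.1 w ->
     c (size p.1) w * c' (size p.2) (alpha w) = F w) ->
  \sum_(p <- s) c (size p.1) w * op_word p.1 (op_adj p.2 (fun y => c' (size p.2) y * g y)) w =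
  if D w then F w * g (alpha w) else 0.
Proof.
have [us sD Ds inj_s] := bis => HF.
case: ifP => [Dw|nDw]; last first.
  rewrite big1_seq// => p /andP[_ ps]; rewrite /op_word; case: ifP; last by rewrite mulr0.
  by move=> wp; have [] := sD p ps w wp; rewrite nDw.
have [p ps wp] := Ds w Dw; have [_ awp tw _] := sD p ps w wp.
rewrite (bigD1_seq p)//= big1_seq ?addr0 => [|q /andP[qp qs]].
  by rewrite /op_word wp tw op_adj_in// mulrA HF.
rewrite /op_word; case: ifP; last by rewrite mulr0.
by move=> wq; rewrite (inj_s q p w qs ps wq wp) eqxx in qp.
Qed.

Lemma op_bisection_adj (g : X -> R[i]) w :
  \sum_(p <- s) op_word p.2 (op_adj p.1 g) w = if D' w then g (beta w) else 0.
Proof.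
have [us sD Ds inj_s] := bis.
have key p : p \in s -> op_word p.2 (op_adj p.1 g) w != 0 ->
    exists y, [/\ in_cylinder p.1 y, D y & alpha y = w].
  move=> ps; rewrite /op_word; case: ifP => [wp|]; last by rewrite eqxx.
  case: op_adjP => [y yp yw _|]; last by rewrite eqxx.
  have [Dy ayp ty _] := sD p ps y yp; exists y; split=> //.
  by apply: in_cylinder_inj ayp wp _; rewrite -ty.
case: ifP => [Dw|nDw]; last first.
  rewrite big1_seq// => p /andP[_ ps].
  apply: contraNeq (negbT nDw) => /(key _ ps)[y [_ Dy <-]].
  by have [] := alphaD Dy.
have [Dv av] := betaD Dw; have [p ps vp] := Ds _ Dv.
have [_ avp tv _] := sD p ps _ vp.
rewrite (bigD1_seq p)//= big1_seq ?addr0 => [|q /andP[qp qs]].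
  by rewrite av in avp tv; rewrite /op_word avp -tv op_adj_in.
apply: contraNeq qp => /(key _ qs)[y [yq Dy ay]].
have [_ yb] := alphaD Dy; rewrite ay in yb.
by apply/eqP; apply: (inj_s q p (beta w)) => //; rewrite yb.
Qed.

Lemma rep_bisection (U : cstarAlgType R) (S : 'I_N -> U) :
  rep S (\sum_(p <- s) S_word S p.1 * cstar (S_word S p.2))
    (fun g w => if D w then g (alpha w) else 0)
    (fun g w => if D' w then g (beta w) else 0).
Proof.
have r (p : seq 'I_N * seq 'I_N) :=
  rep_mul (@rep_word R N A U S p.1) (rep_star (@rep_word R N A U S p.2)).
apply: (rep_ext (rep_sum s r)) => g w /=; last exact: op_bisection_adj.
have H1 p : p \in s -> forall w : X, in_cylinder p.1 w -> 1 * 1 = (fun=> 1 : R[i]) w.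
  by move=> *; rewrite mulr1.
transitivity (if D w then 1 * g (alpha w) else 0); last by rewrite mul1r.
rewrite -(@op_bisection (fun _ _ => 1) (fun _ _ => 1) (fun=> 1) g w H1); apply: eq_bigr => p _.
by rewrite mul1r; congr (op_word _ (op_adj _ _) _); apply/funext => y; rewrite mul1r.
Qed.

End BisectionOperators.

(** * The diagonal and the gauge actions *)

Section ExpC.
Context {R : realType}.

Lemma expCD (a b : R) : expC (a + b) = expC a * expC b.
Proof.
apply/eqP; rewrite eq_complex /= cosD sinD eqxx /=.
by rewrite [X in _ == X]addrC.
Qed.

Lemma expC0 : expC (0 : R) = 1.
Proof. by apply/eqP; rewrite eq_complex /= cos0 sin0 !eqxx. Qed.

Lemma conj_expC (a : R) : (expC a)^*%C = expC (- a).
Proof. by apply/eqP; rewrite eq_complex /= cosN sinN !eqxx. Qed.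

Definition phase (t : R) (n : int) : R[i] := expC (2 * pi * n%:~R * t).

Lemma phaseD t m n : phase t (m + n) = phase t m * phase t n.
Proof. by rewrite /phase -expCD; congr expC; rewrite intrD; ring. Qed.

Lemma phase0 t : phase t 0 = 1.
Proof. by rewrite /phase mulr0 mul0r expC0. Qed.

Lemma phaseN t n : phase t (- n) = phase (- t) n.
Proof. by rewrite /phase; congr expC; rewrite intrN; ring. Qed.

Lemma conj_phase t n : (phase t n)^*%C = phase (- t) n.
Proof. by rewrite conj_expC; congr expC; ring. Qed.

Lemma phaseNK t n : phase t n * phase (- t) n = 1.
Proof. by rewrite -phaseN -phaseD subrr phase0. Qed.

End ExpC.

(** Exactly one term is present in either sum, so an arbitrary [G] passes through. *)
Lemma one_hot_sum (W : Type) (C : zmodType) (s : seq (int * W))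
  (b : W -> bool) (G : int -> C) :
  (\sum_(p <- s) b p.2 = 1)%N ->
  \sum_(p <- s) G p.1 *+ b p.2 = G (\sum_(p <- s) p.1 *+ b p.2).
Proof.
have zero_hot (C' : zmodType) (H : int -> C') s' : (\sum_(p <- s') b p.2 = 0)%N ->
    \sum_(p <- s') H p.1 *+ b p.2 = 0.
  elim: s' => [|p s' IH]; first by rewrite !big_nil.
  by rewrite !big_cons; case: (b p.2) => // /IH; rewrite mulr0n add0r.
elim: s => [|p s IH]; first by rewrite big_nil.
rewrite !big_cons; case: (b p.2) => [[s0]|s1]; last by rewrite !mulr0n !add0r IH.
by rewrite zero_hot// (zero_hot _ id)// !addr0.
Qed.

Section Diagonal.
Context {R : realType} {N : nat} {A : 'M[nat]_N} {U : cstarAlgType R} {S : 'I_N -> U}.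
Local Notation X := (markov_shift A).
Hypothesis A01 : zero_one_mx A.
Hypothesis Airr : irreducible_mx A.
Hypothesis Aperm : ~~ is_perm_mx A.
Hypothesis CK : CK_family A S.

(** By [CK_mul], a vanishing generator makes those of all its successors vanish. Irreducibility
    spreads this to every letter, against the range projections summing to 1. *)
Lemma S_neq0 i : S i != 0.
Proof.
have [_ S1 _] := CK.
apply/eqP => Si0.
have H n k : forall i, S i = 0 -> (0 < (A ^+ n) i k)%N -> S k = 0.
  elim: n => [|n IH] {Si0}i Si0.
    by rewrite expr0 mxE; case: eqVneq => // <-.
  move=> /(expr_mx_gt0 A01)[j Aij]; apply: IH.
  by rewrite -[S j]scale1r -[1]/(1%:R) -Aij -(CK_mul CK) Si0 mulr0 mul0r.
have /eqP : (1 : U) = 0.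
  rewrite -S1 big1// => k _; have [n nk] := Airr i k.
  by rewrite (H n.+1 k i Si0 nk) mul0r.
by rewrite oner_eq0.
Qed.

Lemma S_word_neq0 mu : admissible A mu -> S_word S mu != 0.
Proof.
case: mu => [|i mu]; first by rewrite S_word_nil oner_neq0.
elim: mu i => [|j mu IH] i; first by rewrite S_word_cons S_word_nil mulr1 S_neq0.
rewrite /admissible /= => /andP[/eqP Aij /IH jmu]; apply: contra_neq jmu => ijmu.
have : cstar (S i) * S_word S [:: i, j & mu] = S_word S (j :: mu).
  by rewrite !S_word_cons !mulrA (CK_mul CK) Aij scale1r.
by rewrite ijmu mulr0.
Qed.

Lemma S_proj_neq0 mu : admissible A mu -> S_proj S mu != 0.
Proof.
move=> /S_word_neq0; apply: contra_neq => P0; rewrite -[S_word S mu]cstarK.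
by rewrite (@cstar_mul_eq0 _ _ (cstar (S_word S mu))) ?cstar0// cstarK.
Qed.

Lemma in_cylinder_admissible mu (x : X) : in_cylinder mu x -> admissible A mu.
Proof.
case: mu => // i mu; elim: mu i x => // j mu IH i x.
rewrite in_cylinder_cons => /andP[/eqP x0 xj].
have := IH _ _ xj; rewrite /admissible /= => ->; rewrite andbT -x0; move: xj.
by rewrite in_cylinder_cons => /andP[/eqP <- _]; rewrite (markovP x 0).
Qed.

Lemma S_proj_mul omega mu (x : X) : (size mu <= size omega)%N -> in_cylinder omega x ->
  S_proj S omega * S_proj S mu = (in_cylinder mu x)%:R *: S_proj S omega.
Proof.
move=> mo xo; apply: (rep_inj A01 CK Airr Aperm
  (rep_mul (@rep_proj R N A U S omega) (@rep_proj R N A U S mu))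
  (rep_scale _ (@rep_proj R N A U S omega))) => g y /=.
case: ifP => [yo|]; last by rewrite mulr0.
have xy := in_cylinder_agree xo yo.
suff -> : in_cylinder mu y = in_cylinder mu x.
  by case: ifP; rewrite ?mul1r ?mul0r.
have := agree_le mo xy => /agreeP; by rewrite /in_cylinder => ->.
Qed.

(* Nonvanishing of the [S_proj S mu] makes [C(X_A)] act faithfully in [U]. *)
Lemma partition_of_unity (I : eqType) (s : seq I) (mu : I -> seq 'I_N) :
  \sum_(p <- s) S_proj S (mu p) = 1 ->
  forall x : X, (\sum_(p <- s) in_cylinder (mu p) x = 1)%N.
Proof.
move=> s1 x; pose m := (\sum_(p <- s) size (mu p))%N.
pose omega := mkseq (val x) m.
have xo : in_cylinder omega x := mkseq_in_cylinder x m.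
have Po := S_proj_neq0 (in_cylinder_admissible xo).
have : S_proj S omega * 1 = (\sum_(p <- s) in_cylinder (mu p) x)%:R *: S_proj S omega.
  rewrite -s1 mulr_sumr natr_sum scaler_suml [LHS]big_seq [RHS]big_seq.
  apply: eq_bigr => p ps; apply: S_proj_mul => //.
  by rewrite size_mkseq /m (big_rem p)//= leq_addr.
move/eqP; rewrite mulr1 -subr_eq0 -{1}[S_proj S omega]scale1r -scalerBl scaler_eq0.
by rewrite (negbTE Po) orbF subr_eq0 -[1]/(1%:R) eqr_nat => /eqP.
Qed.

Definition admissible_words m : seq (m.-tuple 'I_N) :=
  [seq mu : m.-tuple 'I_N <- enum {: m.-tuple 'I_N} | admissible A mu].

Lemma tuple_sum (V : nmodType) m (F : m.-tuple 'I_N -> V) (x : X) :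
  \sum_(mu <- admissible_words m)
    (if in_cylinder mu x then F mu else 0) = F [tuple of mkseq (val x) m].
Proof.
rewrite /admissible_words big_filter big_enum_cond /=.
rewrite (bigD1 [tuple of mkseq (val x) m]) /=; last first.
  exact: in_cylinder_admissible (mkseq_in_cylinder x m).
rewrite mkseq_in_cylinder big1 ?addr0// => mu /andP[_ mux].
rewrite /in_cylinder ifF//; apply: contraNF mux => /eqP xmu.
by apply/eqP/val_inj; rewrite /= -xmu size_tuple.
Qed.

Lemma locally_constant_tuple (T : Type) (t0 : T) (f : X -> T) : locally_constant f ->
  exists m (c : m.-tuple 'I_N -> T), forall x, f x = c [tuple of mkseq (val x) m].
Proof.
move=> /locally_constant_uniform[m H].
have /choice[c Hc] : forall mu : m.-tuple 'I_N, exists c, forall x : X,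
    in_cylinder mu x -> f x = c.
  move=> mu; have [[x xmu]|nx] := pselect (exists x : X, in_cylinder mu x).
    exists (f x) => y ymu; apply: H.
    by have := in_cylinder_agree xmu ymu; rewrite size_tuple.
  by exists t0 => x xmu; case: nx; exists x.
by exists m, c => x; apply: Hc; exact: mkseq_in_cylinder.
Qed.

Lemma rep_diagonal (c : X -> R[i]) : locally_constant c ->
  exists2 V, CK_diagonal A S V & rep S V (fun g x => c x * g x) (fun g x => (c x)^*%C * g x).
Proof.
move=> /(locally_constant_tuple 0)[m [d cd]].
exists (\sum_(mu <- admissible_words m)
    d mu *: S_proj S mu).
  have [D0 DZ _ _ _] := cstar_subalgebra_generated
    [set S_proj S mu | mu in [set mu | admissible A mu]].
  rewrite big_seq; apply: (big_ind (CK_diagonal A S)) => [//|x y Dx Dy|mu].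
    by rewrite -[x]scale1r; exact: DZ.
  rewrite mem_filter => /andP[amu _]; rewrite -[_ *: _]addr0; apply: DZ => //.
  by apply: sub_cstar_generated; exists (tval mu).
apply: (rep_ext (rep_sum _ (fun mu : m.-tuple 'I_N =>
    rep_scale (d mu) (@rep_proj R N A U S mu)))) => g x.
  rewrite cd -(tuple_sum (fun mu => d mu * g x)); apply: eq_bigr => mu _.
  by case: ifP; rewrite ?mulr0.
rewrite cd -(tuple_sum (fun mu => (d mu)^*%C * g x)); apply: eq_bigr => mu _.
by case: ifP; rewrite ?mulr0.
Qed.

Lemma cylinder_sum_ex (f : X -> int) : locally_constant f ->
  exists s, cylinder_sum S s f.
Proof.
move=> /(locally_constant_tuple 0)[m [d fd]].
exists [seq (d mu, tval mu) | mu <- admissible_words m].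
split.
- by rewrite all_map; apply/allP => mu; rewrite mem_filter => /andP[].
- move=> x; rewrite fd big_map -(tuple_sum d); apply: eq_bigr => mu _ /=.
  by case: (in_cylinder mu x).
- rewrite big_map; apply: (rep_inj A01 CK Airr Aperm
    (rep_sum _ (fun mu : m.-tuple 'I_N => @rep_proj R N A U S mu)) (rep_one S)) => g x.
  exact: (tuple_sum (fun=> g x)).
Qed.

(** [exp_unitary] uses an unspecified decomposition of [f]. Its projections sum to 1, so its
    cylinders partition the space, and every decomposition acts as the same multiplication operator.
    The first clause is kept because gauge morphisms fix the projections. *)
Lemma exp_unitaryP (f : X -> int) t : locally_constant f ->
  (exists s : seq (R[i] * seq 'I_N), exp_unitary S f t = \sum_(p <- s) p.1 *: S_proj S p.2) /\
  rep S (exp_unitary S f t) (fun g x => phase t (f x) * g x)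
    (fun g x => phase (- t) (f x) * g x).
Proof.
move=> /cylinder_sum_ex[s0 s0f].
have [s [[sa sf s1] ->]] : exists s, cylinder_sum S s f /\ exp_unitary S f t =
    \sum_(p <- s) phase t p.1 *: S_proj S p.2.
  rewrite /exp_unitary; case: xgetP => [_ _ //|H].
  by case: (H _ (ex_intro _ s0 (conj s0f erefl))).
split; first by exists [seq (phase t p.1, p.2) | p <- s]; rewrite big_map.
have one := partition_of_unity s1.
have key (G : int -> R[i]) g x : \sum_(p <- s) G p.1 * (if in_cylinder p.2 x then g x else 0) =
    G (f x) * g x.
  rewrite sf -(@one_hot_sum _ _ s (fun w => in_cylinder w x) G (one x)) mulr_suml.
  apply: eq_bigr => p _.
  by case: (in_cylinder p.2 x); rewrite ?mulr0 ?mul0r.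
apply: (rep_ext (rep_sum _ (fun p : int * seq 'I_N =>
    rep_scale (phase t p.1) (@rep_proj R N A U S p.2)))) => g x; first exact: key.
by rewrite -(key (phase (- t))); apply: eq_bigr => p _; rewrite conj_phase.
Qed.

End Diagonal.

(** * Existence and inverses of the gauge automorphisms *)

Section Gauge.
Context {R : realType} {N : nat} {A : 'M[nat]_N} {U : cstarAlgType R} {S : 'I_N -> U}.
Local Notation X := (markov_shift A).
Hypothesis A01 : zero_one_mx A.
Hypothesis Airr : irreducible_mx A.
Hypothesis Aperm : ~~ is_perm_mx A.

Section GaugeMorphism.
Hypothesis CK : CK_family A S.
Variables (f : X -> int) (t : R) (phi : {lrmorphism U -> U}).
Hypothesis cf : locally_constant f.
Hypothesis phiS : star_morphism phi.
Hypothesis phi_gen : forall j, phi (S j) = exp_unitary S f t * S j.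

(** Each letter contributes the phase of [f], and moving it left past the letters before it composes
    [f] with shifts. The phases accumulate to that of a Birkhoff sum. *)
Lemma rep_gauge_word mu : rep S (phi (S_word S mu))
  (fun g x => phase t (birkhoff f (size mu) x) * op_word mu g x)
  (fun g => op_adj mu (fun y => phase (- t) (birkhoff f (size mu) y) * g y)).
Proof.
elim: mu => [|i mu IH].
  have b0 (x : X) : birkhoff f 0 x = 0 by rewrite /birkhoff big_ord0.
  rewrite S_word_nil rmorph1; apply: (rep_ext (rep_one S)) => g x /=.
    by rewrite b0 phase0 mul1r /op_word /in_cylinder eqxx.
  by rewrite -[x in RHS]/(iter (size ([::] : seq 'I_N)) sigma x) op_adj_in// b0 phase0 mul1r.
have bS (x : X) : birkhoff f (size mu).+1 x = f x + birkhoff f (size mu) (sigma x).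
  by rewrite -addn1 addnC birkhoffD /birkhoff big_ord_recl big_ord0 addr0.
have [_ ru] := exp_unitaryP A01 Airr Aperm CK t cf.
rewrite S_word_cons rmorphM /= phi_gen.
apply: (rep_ext (rep_mul (rep_mul ru (@rep_gen R N A U S i)) IH)) => g x /=.
  rewrite bS phaseD -mulrA; congr (_ * _).
  rewrite [in RHS]op_word_cons /=; set G := op_word mu.
  by rewrite /op_word; case: ifP => // _; rewrite mulr0.
rewrite [in RHS]op_adj_cons /=; congr (op_adj mu _ x); apply/funext => y.
case: op_adjP => [z zi <-|nz].
  by rewrite op_adj_in// bS phaseD mulrCA mulrA.
by rewrite op_adj_out// mulr0.
Qed.

Lemma gauge_proj mu : phi (S_proj S mu) = S_proj S mu.
Proof.
have r := rep_gauge_word mu.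
rewrite /S_proj rmorphM /= phiS.
apply: (rep_inj A01 CK Airr Aperm (rep_mul r (rep_star r)) (@rep_proj R N A U S mu)) => g x /=.
rewrite /op_word; case: ifP => [xmu|]; last by rewrite mulr0.
by rewrite op_adj_in// mulrA phaseNK mul1r.
Qed.

Lemma gauge_exp_unitary (g : X -> int) s : locally_constant g ->
  phi (exp_unitary S g s) = exp_unitary S g s.
Proof.
move=> cg; have [[r ->] _] := exp_unitaryP A01 Airr Aperm CK s cg.
rewrite raddf_sum; apply: eq_bigr => p _.
by rewrite /= linearZ /= gauge_proj.
Qed.

End GaugeMorphism.

Hypothesis Suniv : is_CK_algebra A S.

Lemma exp_unitaryNK (f : X -> int) t : locally_constant f ->
  exp_unitary S f t * exp_unitary S f (- t) = 1.
Proof.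
have [CK _ _] := Suniv => cf.
have [_ r] := exp_unitaryP A01 Airr Aperm CK t cf.
have [_ r'] := exp_unitaryP A01 Airr Aperm CK (- t) cf.
apply: (rep_inj A01 CK Airr Aperm (rep_mul r r') (rep_one S)) => g x /=.
by rewrite mulrA phaseNK mul1r.
Qed.

Lemma cstar_exp_unitary (f : X -> int) t : locally_constant f ->
  cstar (exp_unitary S f t) = exp_unitary S f (- t).
Proof.
have [CK _ _] := Suniv => cf.
have [_ r] := exp_unitaryP A01 Airr Aperm CK t cf.
have [_ r'] := exp_unitaryP A01 Airr Aperm CK (- t) cf.
exact: (rep_inj A01 CK Airr Aperm (rep_star r) r').
Qed.

(** The elements u S_j again form a Cuntz-Krieger family, because u is a unitary that commutes with
    each range projection. *)
Lemma gauge_morphism_ex (f : X -> int) t : locally_constant f ->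
  exists phi : {lrmorphism U -> U},
  star_morphism phi /\ forall j, phi (S j) = exp_unitary S f t * S j.
Proof.
have [CK _ univ] := Suniv => cf; apply: univ.
have [SSS S1 SS] := CK.
set u := exp_unitary S f t.
have us : cstar u = exp_unitary S f (- t) by exact: cstar_exp_unitary.
have uu : cstar u * u = 1 by rewrite us -[in RHS](exp_unitaryNK (- t) cf) opprK.
have uu' : u * cstar u = 1 by rewrite us exp_unitaryNK.
have range j : u * S j * cstar (u * S j) = S j * cstar (S j).
  have [_ r] := exp_unitaryP A01 Airr Aperm CK t cf.
  have rp := @rep_proj R N A U S [:: j].
  have E : u * S_proj S [:: j] = S_proj S [:: j] * u.
    apply: (rep_inj A01 CK Airr Aperm (rep_mul r rp) (rep_mul rp r)) => g x /=.
    by case: ifP; rewrite ?mulr0.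
  rewrite cstarM mulrA; move: E.
  rewrite /S_proj S_word_cons S_word_nil mulr1 -(mulrA u) => ->.
  by rewrite -mulrA uu' mulr1.
split.
- by move=> i; rewrite cstarM -!mulrA [cstar u * _]mulrA uu mul1r !mulrA -(mulrA u)
    -(mulrA u) SSS.
- by rewrite -[RHS]S1; apply: eq_bigr => j _; exact: range.
- move=> i; rewrite cstarM -mulrA [cstar u * _]mulrA uu mul1r SS.
  by apply: eq_bigr => j _; rewrite range.
Qed.

(** Shows that the default of [gauge_action] is not taken. The morphism for -t is inverse to the one
    for t, as both fix the diagonal unitaries of [f]. *)
Lemma gauge_actionP (f : X -> int) t : locally_constant f ->
  gauge_automorphism S f t (gauge_action S f t).
Proof.
have [CK gen univ] := Suniv => cf.
have [phi [phiS phi_gen]] := gauge_morphism_ex t cf.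
have [psi [psiS psi_gen]] := gauge_morphism_ex (- t) cf.
rewrite /gauge_action; apply: xgetPex; exists (phi : U -> U), phi; split=> //.
have eq_id (rho : {lrmorphism U -> U}) : star_morphism rho ->
    (forall j, rho (S j) = S j) -> forall x, rho x = x.
  move=> rhoS rho_gen x.
  apply: (@star_morphism_eq _ _ _ rho idfun (range S)) => //.
  by move=> _ [j _ <-].
exists psi => x.
- apply: (eq_id (psi \o phi : {lrmorphism U -> U})) => [y|j] /=; first by rewrite phiS psiS.
  rewrite phi_gen rmorphM /= psi_gen (gauge_exp_unitary CK cf psiS psi_gen)//.
  by rewrite mulrA exp_unitaryNK// mul1r.
- apply: (eq_id (phi \o psi : {lrmorphism U -> U})) => [y|j] /=; first by rewrite psiS phiS.
  rewrite psi_gen rmorphM /= phi_gen (gauge_exp_unitary CK cf phiS phi_gen)//.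
  by rewrite mulrA -{2}[t]opprK exp_unitaryNK// mul1r.
Qed.

End Gauge.

(** * The isomorphism of Cuntz-Krieger algebras *)

Section WordOperatorIdentities.
Context {R : realType} {N : nat} {A : 'M[nat]_N}.
Local Notation X := (markov_shift A).
Implicit Types (g : X -> R[i]) (x : X).

Lemma op_word_adj mu g x :
  op_word mu (op_adj mu g) x = if in_cylinder mu x then g x else 0.
Proof. by rewrite /op_word; case: ifP => // xmu; rewrite op_adj_in. Qed.

Lemma op_word_partial_isometry mu g x :
  op_word mu (op_adj mu (op_word mu g)) x = op_word mu g x.
Proof. by rewrite op_word_adj /op_word; case: (in_cylinder mu x). Qed.

(** The weights 1 and A(i, j) give the two summation relations needed in [transport_ex]. *)
Lemma op_letter_sum (c : 'I_N -> R[i]) g x :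
  \sum_j c j * op_word [:: j] (op_adj [:: j] g) x = c (val x 0%N) * g x.
Proof.
rewrite (bigD1 (val x 0%N))//= big1 ?addr0 => [|j jx].
  by rewrite op_word_adj in_cylinder_cons eqxx.
by rewrite op_word_adj in_cylinder_cons eq_sym (negbTE jx) mulr0.
Qed.

Lemma op_letter_domain (A01 : zero_one_mx A) i g x :
  op_adj [:: i] (op_word [:: i] g) x = (A i (val x 0%N))%:R * g x.
Proof.
case: op_adjP => [z zi <-|nx].
  rewrite /op_word zi; move: zi; rewrite in_cylinder_cons => /andP[/eqP <- _].
  by rewrite [X in X%:R](markovP z 0 : _ = 1%N) mul1r.
case: (A01 i (val x 0%N)) => [->|Aix]; first by rewrite mul0r.
have [z z0 zx] := cons_ex Aix.
by case: (nx z) => //; rewrite in_cylinder_cons z0 eqxx.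
Qed.

End WordOperatorIdentities.

(** * The morphism of Cuntz-Krieger algebras induced by the orbit equivalence *)

Section Transport.
Context {R : realType} {N M : nat} {A : 'M[nat]_N} {B : 'M[nat]_M}.
Context {UA UB : cstarAlgType R} {SA : 'I_N -> UA} {SB : 'I_M -> UB}.
Hypotheses (A01 : zero_one_mx A).
Hypotheses (B01 : zero_one_mx B) (Birr : irreducible_mx B) (Bperm : ~~ is_perm_mx B).
Hypotheses (SA_univ : is_CK_algebra A SA) (SB_univ : is_CK_algebra B SB).
Local Notation XA := (markov_shift A).
Local Notation XB := (markov_shift B).
Variables (h : XA -> XB) (hinv : XB -> XA) (k l : XA -> nat).
Hypothesis h_homeo : homeomorphism h hinv.
Hypothesis coe : orbit_cocycles h k l.

Definition op_conj (K : (XA -> R[i]) -> XA -> R[i]) (g : XB -> R[i]) (w : XB) : R[i] :=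
  K (g \o h) (hinv w).

Lemma op_conj_comp K L g w : op_conj K (op_conj L g) w = op_conj (K \o L) g w.
Proof.
have [_ _ hK _] := h_homeo; rewrite /op_conj /=; congr (K _ _).
by apply/funext => x; rewrite /= hK.
Qed.

Let domain j := [pred w : XB | in_cylinder [:: j] (hinv w)].
Let shift_conj : XB -> XB := h \o sigma \o hinv.

(** The conjugated shift has exponents [k] and [l]: this is the defining equation of the orbit
    equivalence, read at [hinv w]. The bisection is returned with the operators because its lengths
    enter the gauge computation. *)
Lemma transport_gen j : exists s,
  bisection (domain j) shift_conj (k \o hinv) (l \o hinv) s /\
  rep SB (\sum_(p <- s) S_word SB p.1 * cstar (S_word SB p.2))
    (op_conj (op_word [:: j])) (op_conj (op_adj [:: j])).
Proof.
have [ch chi hK hiK] := h_homeo.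
have [ck cl] := orbit_cocycles_lc coe; have [_ _ hkl] := coe.
have [s bis] : exists s, bisection (domain j) shift_conj (k \o hinv) (l \o hinv) s.
  apply: bisection_ex.
  - apply: (@locally_constant_comp _ _ _ _ _ hinv (fun x => in_cylinder [:: j] x)) => // x.
    by exists 1%N => y xy; rewrite !in_cylinder_cons xy.
  - move=> w; apply: continuous_comp; first exact: chi.
    by apply: continuous_comp; [exact: sigma_continuous|exact: ch].
  - exact: locally_constant_comp.
  - exact: locally_constant_comp.
  - by move=> w _ /=; rewrite hkl hiK.
exists s; split => //.
pose D' : pred XB := fun w => `[< exists z : XA, in_cylinder [:: j] z /\ sigma z = hinv w >].
(* [beta] is the inverse branch of the conjugated shift on its range [D']; off [D'] its value is
   immaterial. *)
have /choice[beta Hb] : forall w, exists v, forall z : XA,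
    in_cylinder [:: j] z -> sigma z = hinv w -> v = h z.
  move=> w; have [[z [zj zw]]|nz] := pselect (exists z : XA,
      in_cylinder [:: j] z /\ sigma z = hinv w); last first.
    by exists w => z zj zw; case: nz; exists z.
  exists (h z) => y yj yw; congr h; apply: (in_cylinder_inj zj yj).
  by rewrite /= zw yw.
apply: (rep_ext (@rep_bisection R M B _ D' _ beta _ _ s bis _ _ UB SB))
  => [w wj|w /asboolP[z [zj zw]]|g w|g w].
- split; first by apply/asboolP; exists (hinv w); rewrite hK.
  by rewrite (Hb _ (hinv w)) ?hK ?hiK.
- by rewrite (Hb _ z)//= hK zj /shift_conj /= hK zw hiK.
- by [].
- rewrite /op_conj; case: ifPn => [/asboolP[z [zj zw]]|/asboolPn nz].
    by rewrite (Hb _ z)// -zw -[sigma z]/(iter (size [:: j]) sigma z) op_adj_in.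
  by rewrite op_adj_out// => z zj zw; apply: nz; exists z.
Qed.

(** The conjugated letter operators satisfy the relations of [A], and faithfulness on the [B] side
    turns these into relations between elements. The last clause, by induction on [rep], is what
    allows the diagonal, the gauge actions and the inverse to be compared on functions. *)
Lemma transport_ex : exists Phi : {lrmorphism UA -> UB},
  [/\ star_morphism Phi,
      forall j, exists2 s, bisection (domain j) shift_conj (k \o hinv) (l \o hinv) s
        & Phi (SA j) = \sum_(p <- s) S_word SB p.1 * cstar (S_word SB p.2)
    & forall V K K', rep SA V K K' -> rep SB (Phi V) (op_conj K) (op_conj K')].
Proof.
have [ch chi hK hiK] := h_homeo.
have [CKB _ _] := SB_univ; have [_ _ univ] := SA_univ.
have [s Hs] := choice transport_gen.
pose T j := \sum_(p <- s j) S_word SB p.1 * cstar (S_word SB p.2).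
have rT j : rep SB (T j) (op_conj (op_word [:: j])) (op_conj (op_adj [:: j])).
  by have [] := Hs j.
have rTT j := rep_mul (rT j) (rep_star (rT j)).
have [|Phi [PhiS Phi_gen]] := univ UB T.
  split.
  - move=> i; apply: (rep_inj B01 CKB Birr Bperm (rep_mul (rTT i) (rT i)) (rT i)) => g w /=.
    by rewrite !op_conj_comp; exact: op_word_partial_isometry.
  - apply: (rep_inj B01 CKB Birr Bperm (rep_sum _ rTT) (rep_one SB)) => g w /=.
    under eq_bigr do rewrite op_conj_comp -[op_conj _ _ _]mul1r.
    by rewrite /op_conj (op_letter_sum (fun=> 1)) mul1r /= hiK.
  - move=> i.
    have r j := rep_scale (A i j)%:R (rTT j).
    have -> : \sum_j T j * cstar (T j) *+ A i j =
        \sum_j (A i j)%:R *: (T j * cstar (T j)).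
      by apply: eq_bigr => j _; rewrite scaler_nat.
    apply: (rep_inj B01 CKB Birr Bperm (rep_mul (rep_star (rT i)) (rT i))
      (rep_sum _ r)) => g w /=.
    under eq_bigr do rewrite op_conj_comp.
    by rewrite op_conj_comp /op_conj /= (op_letter_sum (fun j => (A i j)%:R)) op_letter_domain.
exists Phi; split=> //.
  by move=> j; exists (s j); [have [] := Hs j|exact: Phi_gen].
move=> V K K'; elim=> {V K K'}.
- by move=> i; rewrite Phi_gen.
- rewrite rmorph1; apply: (rep_ext (rep_one SB)) => g w; by rewrite /op_conj /= hiK.
- by move=> V K K' _ IH; rewrite PhiS; exact: rep_star.
- by move=> V K K' W L L' _ IH1 _ IH2; rewrite raddfD; exact: (rep_add IH1 IH2).
- by move=> c V K K' _ IH; rewrite linearZ; exact: (rep_scale c IH).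
- move=> V K K' W L L' _ IH1 _ IH2; rewrite rmorphM.
  by apply: (rep_ext (rep_mul IH1 IH2)) => g w; exact: op_conj_comp.
Qed.

Variable Phi : {lrmorphism UA -> UB}.
Hypothesis PhiS : star_morphism Phi.
Hypothesis Phi_rep : forall V K K', rep SA V K K' -> rep SB (Phi V) (op_conj K) (op_conj K').

Lemma transport_diagonal V : CK_diagonal A SA V -> CK_diagonal B SB (Phi V).
Proof.
have [ch chi hK hiK] := h_homeo; have [CKB _ _] := SB_univ.
apply: (@cstar_generated_min _ _ _ (Phi @^-1` CK_diagonal B SB)).
  by apply: cstar_subalgebra_preimage => //; exact: cstar_subalgebra_generated.
move=> _ [mu _ <-] /=.
have cmu : locally_constant (fun w : XB => (in_cylinder mu (hinv w))%:R : R[i]).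
  apply: (@locally_constant_comp _ _ _ _ _ hinv (fun x => (in_cylinder mu x)%:R)) => // x.
  by exists (size mu) => y /agreeP xy; rewrite /in_cylinder xy.
have [W DW rW] := @rep_diagonal R M B UB SB _ cmu.
suff -> : Phi (S_proj SA mu) = W by [].
apply: (rep_inj B01 CKB Birr Bperm (Phi_rep (@rep_proj R N A UA SA mu)) rW) => g w.
by rewrite /op_conj /= hiK; case: ifP; rewrite ?mul1r ?mul0r.
Qed.

Hypothesis Phi_gen : forall j,
  exists2 s, bisection (domain j) shift_conj (k \o hinv) (l \o hinv) s
    & Phi (SA j) = \sum_(p <- s) S_word SB p.1 * cstar (S_word SB p.2).
Hypotheses (Airr : irreducible_mx A) (Aperm : ~~ is_perm_mx A).

(** On a generator, one side multiplies by the phase of [Psi_map], a difference of Birkhoff sums of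
    lengths l and k. The other gives, on each cylinder of the bisection, such a difference for the
    lengths of the two prefixes. The lags are equal, so [birkhoff_lag] applies. *)
Lemma transport_gauge f t V : continuous_int f ->
  Phi (gauge_action SA (Psi_map h k l f) t V) = gauge_action SB f t (Phi V).
Proof.
have [ch chi hK hiK] := h_homeo.
have [CKA genA _] := SA_univ; have [CKB _ _] := SB_univ.
have [_ _ hkl] := coe.
move=> cf; have /continuous_intP cPsi := Psi_map_continuous ch coe cf.
move/continuous_intP : cf => cf.
have [rA [-> rAS _ rA_gen]] := gauge_actionP A01 Airr Aperm SA_univ t cPsi.
have [rB [-> rBS _ rB_gen]] := gauge_actionP B01 Birr Bperm SB_univ t cf.
apply: (@star_morphism_eq _ _ _ (Phi \o rA : {lrmorphism UA -> UB})
  (rB \o Phi : {lrmorphism UA -> UB}) (range SA)) => //.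
- by move=> x /=; rewrite rAS PhiS.
- by move=> x /=; rewrite PhiS rBS.
move=> _ [j _ <-] /=.
have [_ ru] := exp_unitaryP A01 Airr Aperm CKA t cPsi.
have rl := Phi_rep (rep_mul ru (@rep_gen R N A UA SA j)).
have [s bis PhiE] := Phi_gen j.
have [_ sD _ _] := bis.
have rw p := rep_gauge_word B01 Birr Bperm CKB cf rB_gen p.
have rr := rep_sum s (fun p : seq 'I_M * seq 'I_M => rep_mul (rw p.1) (rep_star (rw p.2))).
rewrite rA_gen PhiE raddf_sum.
under eq_bigr do rewrite /= rmorphM /= rBS.
apply: (rep_inj B01 CKB Birr Bperm rl rr) => g w /=.
rewrite (@op_bisection _ _ _ (domain j) shift_conj _ _ s bis
  (fun n w => phase t (birkhoff f n w)) (fun n w => phase (- t) (birkhoff f n w))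
  (fun w => phase t (Psi_map h k l f (hinv w)))).
  rewrite /op_conj /op_word /=; case: ifP; rewrite ?mulr0//.
move=> p ps v vp; have [_ _ tv lag] := sD p ps v vp.
rewrite -phaseN -phaseD; congr phase; rewrite /Psi_map hiK.
apply: birkhoff_lag (esym tv) _ _; last by rewrite [LHS]lag addnC.
by rewrite /shift_conj /= hkl hiK.
Qed.

End Transport.

Lemma CK_algebra_iso {R : realType} {N M : nat} {A : 'M[nat]_N} {B : 'M[nat]_M}
  (A01 : zero_one_mx A) (Airr : irreducible_mx A) (Aperm : ~~ is_perm_mx A)
  (B01 : zero_one_mx B) (Birr : irreducible_mx B) (Bperm : ~~ is_perm_mx B)
  (h : markov_shift A -> markov_shift B) (hinv : markov_shift B -> markov_shift A)
  (h_homeo : homeomorphism h hinv)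
  (k1 l1 : markov_shift A -> nat) (k2 l2 : markov_shift B -> nat)
  (coe_h : orbit_cocycles h k1 l1) (coe_hinv : orbit_cocycles hinv k2 l2)
  (OA OB : cstarAlgType R) (SA : 'I_N -> OA) (SB : 'I_M -> OB)
  (OA_univ : is_CK_algebra A SA) (OB_univ : is_CK_algebra B SB) :
  exists Phi : {lrmorphism OA -> OB},
    [/\ star_morphism Phi, bijective Phi,
        Phi @` CK_diagonal A SA = CK_diagonal B SB
      & forall f : markov_shift B -> int, continuous_int f ->
          forall (t : R) (x : OA),
            Phi (gauge_action SA (Psi_map h k1 l1 f) t x) = gauge_action SB f t (Phi x)].
Proof.
have h_homeo' := homeomorphism_sym h_homeo.
have [_ _ hK hiK] := h_homeo.
have [CKA genA _] := OA_univ; have [CKB genB _] := OB_univ.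
have [Phi [PhiS Phi_gen Phi_rep]] :=
  transport_ex A01 B01 Birr Bperm OA_univ OB_univ h_homeo coe_h.
have [Psi [PsiS _ Psi_rep]] :=
  transport_ex B01 A01 Airr Aperm OB_univ OA_univ h_homeo' coe_hinv.
have PhiK : cancel Phi Psi.
  apply: (@star_morphism_eq _ _ _ (Psi \o Phi : {lrmorphism OA -> OA}) idfun (range SA)) => //.
    by move=> x /=; rewrite PhiS PsiS.
  move=> _ [j _ <-] /=; have r := @rep_gen R N A OA SA j.
  apply: (rep_inj A01 CKA Airr Aperm (Psi_rep _ _ _ (Phi_rep _ _ _ r)) r) => g x.
  rewrite /op_conj hK; congr (op_word _ _ x).
  by apply/funext => y /=; rewrite hK.
have PsiK : cancel Psi Phi.
  apply: (@star_morphism_eq _ _ _ (Phi \o Psi : {lrmorphism OB -> OB}) idfun (range SB)) => //.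
    by move=> x /=; rewrite PsiS PhiS.
  move=> _ [j _ <-] /=; have r := @rep_gen R M B OB SB j.
  apply: (rep_inj B01 CKB Birr Bperm (Phi_rep _ _ _ (Psi_rep _ _ _ r)) r) => g x.
  rewrite /op_conj hiK; congr (op_word _ _ x).
  by apply/funext => y /=; rewrite hiK.
exists Phi; split=> //; first by exists Psi.
  apply/seteqP; split=> [_ [V DV <-]|W DW].
    exact: (transport_diagonal B01 Birr Bperm OB_univ h_homeo PhiS Phi_rep).
  exists (Psi W); last exact: PsiK.
  exact: (transport_diagonal A01 Airr Aperm OA_univ h_homeo' PsiS Psi_rep).
move=> f cf t x.
exact: (transport_gauge A01 B01 Birr Bperm OA_univ OB_univ h_homeo coe_h PhiS Phi_rep Phi_gen).
Qed.

Theorem theorem1p4 (R : realType) (N M : nat)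
  (A : 'M[nat]_N) (B : 'M[nat]_M)
  (A01 : zero_one_mx A) (Airr : irreducible_mx A) (Aperm : ~~ is_perm_mx A)
  (B01 : zero_one_mx B) (Birr : irreducible_mx B) (Bperm : ~~ is_perm_mx B)
  (h : markov_shift A -> markov_shift B) (hinv : markov_shift B -> markov_shift A)
  (h_homeo : homeomorphism h hinv)
  (k1 l1 : markov_shift A -> nat) (k2 l2 : markov_shift B -> nat)
  (coe_h : orbit_cocycles h k1 l1) (coe_hinv : orbit_cocycles hinv k2 l2)
  (OA OB : cstarAlgType R) (SA : 'I_N -> OA) (SB : 'I_M -> OB)
  (OA_univ : is_CK_algebra A SA) (OB_univ : is_CK_algebra B SB) :
  [/\ exists Phi : {lrmorphism OA -> OB},
        [/\ star_morphism Phi, bijective Phi,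
            Phi @` CK_diagonal A SA = CK_diagonal B SB
          & forall f : markov_shift B -> int, continuous_int f ->
              forall (t : R) (x : OA),
                Phi (gauge_action SA (Psi_map h k1 l1 f) t x) = gauge_action SB f t (Phi x)],
      exists xi : {multiplicative full_group A -> full_group B},
        bijective xi /\
        forall f : markov_shift B -> int, continuous_int f ->
          xi @` cocycle_subgroup (Psi_map h k1 l1 f) = cocycle_subgroup f
    & exists Phi_h : {additive H1 A -> H1 B},
        bijective Phi_h /\
        forall f : markov_shift B -> int, continuous_int f ->
          Phi_h (H1_class (rho_cocycle (Psi_map h k1 l1 f))) = H1_class (rho_cocycle f)].
Proof.
split.
- exact: (CK_algebra_iso A01 Airr Aperm B01 Birr Bperm h_homeo coe_h coe_hinv).
- exact: (full_group_conj_iso A01 Airr Aperm B01 Birr Bperm h_homeo coe_h coe_hinv).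
- exact: (cohomology_iso A01 Airr Aperm B01 Birr Bperm h_homeo coe_h coe_hinv).
Qed.
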